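(* Let $n\geq 1$, $0\leq k\leq n$, and let $J$ be an open real interval. Suppose that $C_{n+1}(t)=(c_{r-s}(t))_{r,s=0}^n$ is real symmetric and positive definite on $J$, with $C^1$ entries and only $c_{\pm k}$ varying with $t$. Put $b=(-1)^n$, let $P_{n+1}(z,b;t)=zQ_n(z;t)-\overline b\,Q_n^*(z;t)$ be the associated paraorthogonal polynomial (see context), and set $$p(z;t)=(-1)^{n+1}P_{n+1}(-z,b;t).$$ Suppose that all coefficients of $p(\cdot;t)$ are non-negative for every $t\in J$. (This holds, in particular, if $C_{n+1}(t)$ is totally non-negative for every $t\in J$.) Let $\zeta(t)=e^{i\varphi(t)}$, $0<\varphi(t)<\pi$, be the zero of $P_{n+1}(\cdot,b;t)$ in the open upper half-plane nearest to $-1$. For $1\leq k\leq n$, this zero moves clockwise: $\varphi$ is non-increasing on $J$ when $(-1)^kc_k(t)$ is non-increasing, and strictly decreasing when $(-1)^kc_k(t)$ is strictly decreasing. For $k=0$, $\varphi$ is non-increasing when $c_0(t)$ is non-increasing; and $\varphi$ is strictly decreasing when $c_0(t)$ is strictly decreasing provided that $p(\cdot;t)\ne 1+z^{n+1}$ for every $t\in J$.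
   Context: A matrix is totally non-negative if every one of its minors is non-negative. Here $c_{-j}=c_j$. With $C_n=(c_{r-s})_{r,s=0}^{n-1}$, the monic orthogonal polynomial of degree $n$ is $$Q_n(z)=\frac{1}{\det C_n}\det\begin{pmatrix} c_0&c_{-1}&\cdots&c_{-n}\\ c_1&c_0&\cdots&c_{1-n}\\ \vdots&\vdots&&\vdots\\ c_{n-1}&c_{n-2}&\cdots&c_{-1}\\ 1&z&\cdots&z^n\end{pmatrix};$$ equivalently, it is the monic polynomial of degree $n$ orthogonal to $1,z,\ldots,z^{n-1}$ for $\langle f,g\rangle=\mathcal L[\overline f g]$, where $\mathcal L[z^j]=c_{-j}$ for $|j|\leq n$ and conjugation is taken on the unit circle ($\overline z=z^{-1}$). The reversed polynomial is $Q_n^*(z)=z^n\overline{Q_n(1/\overline z)}$, with value at $z=0$ by polynomial continuation. The polynomial $P_{n+1}(\cdot,b;t)$ is monic of degree $n+1$ with $n+1$ simple zeros, all on the unit circle; for real data and $b=\pm1$ its non-real zeros occur in conjugate pairs. Clockwise motion of a zero $e^{i\varphi(t)}$ means that its argument $\varphi(t)$ decreases as $t$ increases. *)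

(* Defs.v *)
From HB Require Import structures.
From mathcomp Require Import all_boot all_order all_algebra.
From mathcomp Require Import all_classical all_reals all_analysis.
From mathcomp Require Import complex.

Set Implicit Arguments.
Unset Strict Implicit.
Unset Printing Implicit Defensive.

Import Order.TTheory GRing.Theory Num.Theory.
Import numFieldNormedType.Exports.

Local Open Scope classical_set_scope.
Local Open Scope complex_scope.
Local Open Scope ring_scope.

Definition toeplitz (K : Type) (m : nat) (c : int -> K) : 'M[K]_m :=
  \matrix_(r < m, s < m) c (r%:Z - s%:Z).

Definition posdef (R : numDomainType) (m : nat) (A : 'M[R]_m) : Prop :=
  forall x : 'cV[R]_m, x != 0 -> 0 < (x^T *m A *m x) 0 0.

Definition totally_nonneg (R : numDomainType) (m : nat) (A : 'M[R]_m) : Prop :=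
  forall (l : nat) (f g : 'I_l -> 'I_m),
    {homo f : i j / (i < j)%N} -> {homo g : i j / (i < j)%N} ->
    0 <= \det (mxsub f g A).

Definition orthopoly_mx (K : fieldType) (n : nat) (c : int -> K) :
    'M[{poly K}]_n.+1 :=
  \matrix_(r < n.+1, s < n.+1)
    if (r < n)%N then (c (r%:Z - s%:Z))%:P else 'X^s.

Definition orthopoly (K : fieldType) (n : nat) (c : int -> K) : {poly K} :=
  (\det (toeplitz n c))^-1 *: \det (orthopoly_mx n c).

(* The polynomial z |-> z^n conj(q(1/conj z)) for deg q <= n: see revpolyE. *)
Definition revpoly (K : numClosedFieldType) (n : nat) (q : {poly K}) :
    {poly K} :=
  \poly_(j < n.+1) (q`_(n - j))^*.

Lemma revpolyE (K : numClosedFieldType) (n : nat) (q : {poly K}) (z : K) :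
  (size q <= n.+1)%N -> z != 0 ->
  (revpoly n q).[z] = z ^+ n * (q.[(z^*)^-1])^*.
Proof.
move=> sq z0; rewrite horner_poly (horner_coef_wide _ sq).
rewrite rmorph_sum mulr_sumr (reindex_inj rev_ord_inj) /=.
apply: eq_bigr => i _; rewrite subSS subKn; last by rewrite -ltnS.
rewrite rmorphM rmorphXn fmorphV /= conjCK.
have -> : z ^+ n = z ^+ (n - i) * z ^+ i by rewrite -exprD subnK // -ltnS.
by rewrite exprVn mulrCA -[in RHS]mulrA mulfV ?mulr1 // expf_neq0.
Qed.

(* The degree-(n+1) polynomial z Q_n(z) - conj(b) (Q_n)^*(z). *)
Definition paraorthopoly (K : numClosedFieldType) (n : nat) (c : int -> K)
    (b : K) : {poly K} :=
  'X * orthopoly n c - b^* *: revpoly n (orthopoly n c).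

Definition flippoly (K : fieldType) (n : nat) (P : {poly K}) : {poly K} :=
  (-1) ^+ n.+1 *: (P \Po (- 'X)).

(* Over K = R[i], 0 <= z means that z is real and non-negative. *)
Definition nonneg_coefs (K : numDomainType) (p : {poly K}) : Prop :=
  forall j : nat, 0 <= p`_j.

Definition expi (R : realType) (x : R) : R[i] := cos x +i* sin x.

(* exp(i x) is, among the roots of P in the open upper half-plane, one nearest
   to -1. *)
Definition upper_root_nearest_m1 (R : realType) (P : {poly R[i]}) (x : R) :
    Prop :=
  [/\ 0 < x < pi, root P (expi x) &
      forall w : R[i], root P w -> 0 < complex.Im w ->
        `|expi x - (-1)| <= `|w - (-1)| ].

Definition C1_on (R : realType) (J : set R) (f : R -> R) : Prop :=
  {in J, forall t, derivable f t 1} /\ {in J, continuous (derive1 f)}.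

Definition noninc_on (R : realType) (J : set R) (f : R -> R) : Prop :=
  {in J &, {homo f : s t / s <= t >-> t <= s}}.

Definition strict_dec_on (R : realType) (J : set R) (f : R -> R) : Prop :=
  {in J &, {homo f : s t / s < t >-> t < s}}.

(* Main.v *)
Require Import Defs.
From mathcomp Require Import all_boot all_order all_algebra.
From mathcomp Require Import all_classical all_reals all_analysis.
From mathcomp Require Import complex.
From mathcomp Require Import ring lra zify.

Import Order.TTheory GRing.Theory Num.Theory.
Import numFieldNormedType.Exports.

Local Open Scope classical_set_scope.
Local Open Scope complex_scope.
Local Open Scope ring_scope.

(** The substitution z -> -z turns P into a monic self-reciprocal polynomial p
    with real coefficients, p = z q + q^*, where q is the orthogonal polynomial
    of the moments d_j = (-1)^j c_j, and it turns the zero e^(i phi) nearest to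
    -1 into the zero e^(i theta) of p nearest to 1, with theta = pi - phi.  It
    must be shown that theta grows when d_k decreases.  No derivative in t is
    taken: two parameters are compared directly, through a variational
    characterization of theta.

    Write L for the functional with moments d, and factor
    p = (z^2 - 2 cos(theta) z + 1) g.  Since p is orthogonal to z, ..., z^n,
    L[(z + 1/z - 2 cos theta) g conj(h)] = 0 for all h of degree less than n,
    so 2 cos(theta) is an eigenvalue of the pencil of quadratic forms
    A(h) = L[(z + 1/z) |h|^2], B(h) = L[|h|^2].  On self-reciprocal h it is the
    largest one: a maximizer h of A/B yields a self-reciprocal polynomial
    (z^2 - l z + 1) h with the orthogonality relations of p, hence a multiple of
    p, and l = 2 Re w for a zero w of p ([rayleigh_max]).

    Let now s < t, with theta_s, theta_t and p, g taken at t.  Inserting g at s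
    gives
      (2 cos theta_s - 2 cos theta_t) B_s(g)
        >= A_s(g) - 2 cos(theta_t) B_s(g) = (d_k(s) - d_k(t)) D,
    where D is the sum of all g_i p_j with |i + 1 - j| = k ([rayleigh_gap]).
    Everything reduces to the signs of the coefficients: p has non-negative ones
    by hypothesis, and those of g are then positive, so D >= 0.  For k >= 1 the
    sum D contains g_(k-1) p_0 > 0; for k = 0 it vanishes only if
    p = 1 + z^(n+1), which is the exceptional case.

    The positivity of g ([nearest_zeros_quotient_gt0]) says that removing from a
    polynomial with non-negative coefficients, and with zeros on the unit circle,
    the pair of zeros closest to the positive axis leaves positive coefficients,
    provided that these zeros are simple.  On the ray r e^(i theta), divide p by
    1 - r, as p vanishes at r = 1; the imaginary part of the quotient,
    rotated by e^(-i (j+1) theta), is a real polynomial in r whose coefficients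
    T_i are the partial sums of the p_l sin((l - j - 1) theta), and
    T_j = - g_j sin(theta).  As the zeros of g lie outside the sector
    |arg z| <= theta, the argument of the quotient winds by (n+1) theta - pi
    along the ray, which forces many sign alternations.  If g_j <= 0, the
    coefficients T_i, monotone on each block of constant sign of the sine, have
    too few sign changes for Descartes' rule. *)

Set Implicit Arguments.
Unset Strict Implicit.
Unset Printing Implicit Defensive.

(** * Descartes' rule of signs for exponential sums *)

Definition expsum (R : realType) (n : nat) (x a : 'I_n -> R) (s : R) : R :=
  \sum_(i < n) a i * expR (x i * s).

Lemma is_derive_expsum (R : realType) (n : nat) (x a : 'I_n -> R) (s : R) :
  is_derive s 1 (expsum x a) (expsum x (fun i => x i * a i) s).
Proof.
have -> : expsum x a = \sum_(i < n) (fun s => a i * expR (x i * s)).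
  by apply/funext => u; rewrite fct_sumE.
rewrite /expsum; apply: is_derive_sum => i.
apply: (@is_derive_eq _ _ _ (fun s => a i * expR (x i * s))).
by rewrite /GRing.scale/= ; ring.
Qed.

Lemma expsumM (R : realType) (n : nat) (x a : 'I_n -> R) (e s : R) :
  expsum (fun i => x i - e) a s = expR (- e * s) * expsum x a s.
Proof.
rewrite /expsum mulr_sumr; apply: eq_bigr => i _.
by rewrite mulrCA -expRD -mulrDl [- e + _]addrC.
Qed.

(** Multiplying the sum by the positive function exp(-e s) keeps its signs, and
    then differentiating multiplies the coefficient of the exponent x by x - e:
    one sign change of the coefficients is traded for one sign change of the
    function. *)
Lemma expsum_rolle (R : realType) (n : nat) (x a : 'I_n -> R) (e u v w : R) :
  u < v -> w * expsum x a u < 0 -> 0 < w * expsum x a v ->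
  exists2 c, u < c < v & 0 < w * expsum x (fun i => (x i - e) * a i) c.
Proof.
move=> uv Fu Fv; pose y i := x i - e.
have [c cuv] := @MVT R _ _ _ _ uv (fun s _ => is_derive_expsum y a s)
  (derivable_within_continuous
     (fun s _ => @ex_derive _ _ _ _ _ _ _ (is_derive_expsum y a s))).
rewrite in_itv/= in cuv => /(congr1 (fun z => w * z)).
rewrite !expsumM mulrBr => cE; exists c => //.
have dvu : 0 < v - u by rewrite subr_gt0.
have ec : 0 < expR (- e * c) by exact: expR_gt0.
rewrite -(pmulr_rgt0 _ ec) mulrCA -(pmulr_lgt0 _ dvu) -[X in 0 < X]mulrA -cE subr_gt0.
apply: (@lt_trans _ _ 0).
  by rewrite mulrCA pmulr_rlt0 ?expR_gt0.
by rewrite mulrCA pmulr_rgt0 ?expR_gt0.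
Qed.

(** The list [es] encodes the sign changes of the coefficients as exponents at
    which they may occur; then the function cannot alternate in sign at
    [(size es).+1] points if its last sign is opposite to the last sign [w] of
    the coefficients.  Real thresholds with a sign condition that is void at a
    threshold are easier to construct than a count of sign changes. *)
Lemma expsum_descartes (R : realType) (n : nat) (x a : 'I_n -> R) (es : seq R)
    (w : R) (s : nat -> R) :
  (forall i, 0 <= w * a i * \prod_(e <- es) (x i - e)) ->
  (forall m, (m < size es)%N -> s m < s m.+1) ->
  ~ (forall m, (m <= size es)%N ->
       w * (-1) ^+ (size es - m) * expsum x a (s m) < 0).
Proof.
elim: es a s => [|e es IH] a s ha hs hF.
  have := hF 0%N isT; rewrite subn0 expr0 mulr1 ltNge => /negP[].
  rewrite mulr_sumr; apply: sumr_ge0 => i _; rewrite mulrA mulr_ge0 ?expR_ge0//.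
  by have := ha i; rewrite big_nil mulr1.
have mid m : exists c, (m <= size es)%N -> s m < c < s m.+1 /\
    w * (-1) ^+ (size es - m) * expsum x (fun i => (x i - e) * a i) c < 0.
  case: (leqP m (size es)) => [mM|_]; last by exists 0.
  have h0 := hF m (leqW mM); have h1 := hF m.+1 mM.
  rewrite /= subSS in h1; rewrite /= subSn// exprS in h0.
  have [||c cs hc] := @expsum_rolle R n x a e _ _
    (- (w * (-1) ^+ (size es - m))) (hs m mM).
  - by rewrite (_ : - _ = w * (-1 * (-1) ^+ (size es - m))) //; ring.
  - by rewrite mulNr oppr_gt0.
  by exists c => _; split => //; rewrite mulNr oppr_gt0 in hc.
have [c hc] := choice mid.
apply: (IH (fun i => (x i - e) * a i) c) => [i|m mM|m mM].
- by have := ha i; rewrite big_cons; congr (0 <= _); ring.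
- have [/andP[_ h1] _] := hc m (ltnW mM).
  by have [/andP[h2 _] _] := hc m.+1 mM; exact: lt_trans h2.
- by have [] := hc m mM.
Qed.

(** * Winding of complex-valued functions on the unit interval *)

Lemma expiD (R : realType) (x y : R) : expi (x + y) = expi x * expi y.
Proof. by rewrite /expi cosD sinD; simpc; congr (_ +i* _); rewrite addrC. Qed.

Lemma expi0 (R : realType) : expi 0 = 1 :> R[i].
Proof. by rewrite /expi cos0 sin0. Qed.

Definition turns (R : realType) (f : R -> R[i]) (A B : R) : Prop :=
  exists v : R -> R, [/\ continuous v, v 0 = A, v 1 = B &
    forall u, 0 <= u <= 1 -> exists2 r, 0 < r & f u = r%:C * expi (v u)].

Lemma turnsM (R : realType) (f g : R -> R[i]) (A B C D : R) :
  turns f A B -> turns g C D -> turns (fun u => f u * g u) (A + C) (B + D).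
Proof.
move=> [v [cv v0 v1 hv]] [w [cw w0 w1 hw]].
exists (fun u => v u + w u); split=> [u|||u hu]; rewrite ?v0 ?w0 ?v1 ?w1//.
  by apply: cvgD; [exact: cv|exact: cw].
have [r r0 ->] := hv u hu; have [q q0 ->] := hw u hu.
by exists (r * q); rewrite ?mulr_gt0// expiD rmorphM mulrACA.
Qed.

Lemma turns_const (R : realType) (r : R) : 0 < r -> turns (fun=> r%:C) 0 0.
Proof.
move=> r0; exists (fun=> 0); split=> // [u|u _]; first exact: cvg_cst.
by exists r; rewrite // expi0 mulr1.
Qed.

(** The segment from 1 to e^(i d) stays, after rotation by -d/2, in the right
    half-plane, where the arctangent is a continuous argument. *)
Lemma turns_segment (R : realType) (d : R) : - pi < d < pi ->
  turns (fun u => (1 - u)%:C + u%:C * expi d) 0 d.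
Proof.
have [e ->] : exists e : R, d = e + e by exists (d / 2); rewrite -splitr.
move=> hd.
have he : - (pi / 2) < e < pi / 2 by case/andP: hd => h1 h2; apply/andP; split; lra.
have c0 : 0 < cos e by exact: cos_gt0_pihalf.
have tE : tan e * cos e = sin e by rewrite /tan divfK // gt_eqF.
exists (fun u => e + atan ((u + u - 1) * tan e)); split.
- move=> u; apply: cvgD; first exact: cvg_cst.
  apply: continuous_cvg; first exact: continuous_atan.
  apply: cvgM; last exact: cvg_cst.
  by apply: cvgB; [apply: cvgD; exact: cvg_id|exact: cvg_cst].
- by rewrite addr0 sub0r mulN1r atanN tanK ?subrr// in_itv.
- by rewrite addrK mul1r tanK// in_itv.
move=> u _; set z := (u + u - 1) * tan e.
(* The modulus of 1 + i z, whose argument is [atan z]. *)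
have q0 : 0 < Num.sqrt (1 + z ^+ 2).
  by rewrite sqrtr_gt0 ltr_pwDl// sqr_ge0.
exists (cos e * Num.sqrt (1 + z ^+ 2)); first exact: mulr_gt0.
have za : Num.sqrt (1 + z ^+ 2) * cos (atan z) = 1.
  by rewrite cos_atan mulfV// gt_eqF.
have zs : Num.sqrt (1 + z ^+ 2) * sin (atan z) = z.
  rewrite -[in RHS](atanK z) /tan cos_atan invrK mulrC //.
have zE : z * cos e = (u + u - 1) * sin e by rewrite -tE mulrA.
have cs := cos2Dsin2 e.
rewrite !expiD /expi; set q := Num.sqrt _ in q0 za zs *.
set ca := cos (atan z) in za *; set sa := sin (atan z) in zs *.
have ze (x : R) : x%:C = x +i* 0 by [].
simpc; congr (_ +i* _).
  transitivity ((q * ca) * cos e ^+ 2 - (q * sa * cos e) * sin e); last by ring.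
    rewrite za zs zE; apply/eqP; rewrite -subr_eq0; apply/eqP.
  transitivity ((1 - u) * (1 - (cos e ^+ 2 + sin e ^+ 2))); first by ring.
  by rewrite cs subrr mulr0.
transitivity ((q * sa * cos e) * cos e + (q * ca) * cos e * sin e); last by ring.
by rewrite za zs zE; ring.
Qed.

Lemma root_conj (R : realType) (p : {poly R}) (z : R[i]) :
  root (map_poly (real_complex R) p) z ->
  root (map_poly (real_complex R) p) z^*%C.
Proof.
rewrite -complex_root_conj -map_poly_comp.
by rewrite (@eq_map_poly _ _ _ (real_complex R))// => x; exact: conjc_real.
Qed.

Lemma dvdp_real_quadratic (R : realType) (p : {poly R}) (z : R[i]) :
  root (map_poly (real_complex R) p) z -> complex.Im z != 0 ->
  'X^2 - (2 * complex.Re z) *: 'X + (complex.Re z ^+ 2 + complex.Im z ^+ 2)%:P %| p.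
Proof.
move=> pz nz; rewrite -(dvdp_map (real_complex R)).
have -> : map_poly (real_complex R)
    ('X^2 - (2 * complex.Re z) *: 'X + (complex.Re z ^+ 2 + complex.Im z ^+ 2)%:P) =
    \prod_(w <- [:: z; z^*%C]) ('X - w%:P).
  rewrite !big_cons big_nil mulr1 rmorphD rmorphB /= map_polyXn map_polyC.
  rewrite linearZ /= map_polyX; apply/polyP => i; case: z {pz nz} => a b.
  rewrite mulrBl !mulrBr -polyCM.
  rewrite !(coefD, coefN, coefC, coefZ, coefXn, coefXM, coefMX, coefX, coefCM).
  case: i => [|[|[|i]]] /=; simpc; congr (_ +i* _); ring.
apply: uniq_roots_dvdp; first by rewrite /= pz root_conj.
rewrite uniq_rootsE /= inE andbT; apply: contra nz => /eqP/(congr1 (@complex.Im R)).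
by case: z {pz} => a b /= h; apply/eqP; lra.
Qed.

Lemma expipi (R : realType) : expi pi = -1 :> R[i].
Proof. by rewrite /expi cospi sinpi; simpc. Qed.

Lemma expiNpi (R : realType) : expi (- pi) = -1 :> R[i].
Proof. by rewrite /expi cosN sinN cospi sinpi; simpc. Qed.

Local Notation quad a := ('X^2 - a *: 'X + 1%:P).

Lemma size_quad (R : realType) (a : R) :
  size (quad a) = 3%N.
Proof.
rewrite -addrA size_polyDl size_polyXn// (leq_ltn_trans (size_polyD _ _))//.
rewrite size_polyN size_polyC oner_eq0 ltnS geq_max andbT.
by rewrite (leq_trans (size_scale_leq _ _))// size_polyX.
Qed.

Lemma horner_map_quad (R : realType) (a : R) (z : R[i]) :
  (map_poly (real_complex R) (quad a)).[z] = z ^+ 2 - a%:C * z + 1.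
Proof.
have -> : map_poly (real_complex R) (quad a) = 'X^2 - a%:C *: 'X + 1%:P.
  by rewrite raddfD raddfB /= map_polyZ map_polyXn map_polyX map_polyC.
by rewrite !hornerE.
Qed.

Definition circle_roots_left_of (R : realType) (x : R) (g : {poly R}) : Prop :=
  forall w : R[i], root (map_poly (real_complex R) g) w ->
    complex.Re w ^+ 2 + complex.Im w ^+ 2 = 1 /\ complex.Re w < x.

Lemma circle_roots_left_of_dvd (R : realType) (x : R) (p g : {poly R}) :
  circle_roots_left_of x (p * g) -> circle_roots_left_of x p.
Proof. by move=> h w pw; apply: h; rewrite rmorphM rootM pw. Qed.

(** The ray r e^(i th), 0 <= r < oo, is parametrized by r = u / (1 - u); the
    factor (1 - u)^(deg g) makes the value extend continuously to u = 1. *)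
Definition turns_along (R : realType) (th : R) (g : {poly R}) (A B : R) : Prop :=
  exists2 f, turns f A B & forall u, u < 1 -> f u =
    ((1 - u) ^+ (size g).-1)%:C *
    (map_poly (real_complex R) g).[(u / (1 - u))%:C * expi th].

Lemma turns_alongM (R : realType) (th : R) (p g : {poly R}) (A B C D : R) :
  p * g != 0 -> turns_along th p A B -> turns_along th g C D ->
  turns_along th (p * g) (A + C) (B + D).
Proof.
rewrite mulf_eq0 negb_or => /andP[p0 g0] [f tf hf] [k tk hk].
exists (fun u => f u * k u); first exact: turnsM.
move=> u u1; rewrite hf// hk// [map_poly _ (_ * _)]rmorphM hornerM size_mul//.
rewrite mulrACA -(rmorphM (real_complex R)) -exprD.
congr ((_ ^+ _)%:C * _).
rewrite -size_poly_gt0 in p0; rewrite -size_poly_gt0 in g0.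
by case: (size p) p0 (size g) g0 => // a _ [|b]// _; rewrite addSn addnS.
Qed.

Lemma turns_along_const (R : realType) (th c : R) :
  0 < c -> turns_along th c%:P 0 0.
Proof.
move=> c0; exists (fun=> c%:C); first exact: turns_const.
by move=> u _; rewrite size_polyC gt_eqF//= expr0 mul1r map_polyC hornerC.
Qed.

Lemma turns_along_linear (R : realType) (th : R) : 0 < th < pi ->
  turns_along th ('X + 1%:P) 0 th.
Proof.
case/andP=> th0 thpi; exists (fun u => (1 - u)%:C + u%:C * expi th).
  by apply: turns_segment; rewrite thpi andbT; have := pi_gt0 R; lra.
move=> u u1; rewrite size_XaddC /= expr1 [map_poly _ _]rmorphD /= map_polyX map_polyC.
have u0 : 1 - u != 0 by rewrite subr_eq0 gt_eqF.
rewrite !hornerE mulrDr mulrA -rmorphM /= mulrCA mulfV// mulr1 mulr1.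
by rewrite addrC.
Qed.

Lemma turns_along_quad (R : realType) (th a : R) : 0 < th < pi ->
  -1 < a -> a < cos th ->
  turns_along th (quad (2 * a)) 0 (th + th).
Proof.
case/andP=> th0 thpi aN1 ath.
have a1 : a <= 1 by rewrite (le_trans (ltW ath))// cos_le1.
have aI : -1 <= a <= 1 by rewrite ltW.
pose psi := acos a.
have psi0 : 0 <= psi by exact: acos_ge0.
have psipi : psi < pi by apply: acos_ltpi; rewrite aN1.
have psiE : cos psi = a by rewrite acosK.
have thpsi : th < psi.
  by rewrite -ltr_cos ?psiE// in_itv/= ?psi0 ltW//= ltW.
(* Up to the factor 1 - u, 1 - z e^(i psi) and 1 - z e^(-i psi) at
   z = r e^(i th) are segments from 1 to e^(i (th +- (psi - pi))). *)
exists (fun u => ((1 - u)%:C + u%:C * expi (pi + th - psi)) *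
                 ((1 - u)%:C + u%:C * expi (th + psi - pi))).
  have -> : th + th = (pi + th - psi) + (th + psi - pi) by ring.
  rewrite -[X in turns _ X](addr0 0).
  by apply: turnsM; apply: turns_segment; apply/andP; split; lra.
move=> u u1; rewrite size_quad.
have u0 : (1 - u)%:C != 0 :> R[i].
  by rewrite (inj_eq (@complexI R)) subr_eq0 gt_eqF.
rewrite horner_map_quad; set e := expi th.
have e1 : expi (pi + th - psi) = - e * expi (- psi).
  by rewrite (expiD (pi + th)) (expiD pi) expipi mulN1r.
have e2 : expi (th + psi - pi) = - e * expi psi.
  by rewrite (expiD (th + psi)) (expiD th) expiNpi mulrN1 mulNr.
have ep : expi psi * expi (- psi) = 1 by rewrite -expiD subrr expi0.
have es : expi psi + expi (- psi) = (2 * a)%:C.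
  rewrite /expi cosN sinN psiE; simpc.
  by apply: (congr1 (real_complex R)); ring.
rewrite e1 e2 rmorphXn /= [(u / (1 - u))%:C]rmorphM/= fmorphV/= expr2.
transitivity ((1 - u)%:C ^+ 2 - (1 - u)%:C * u%:C * e * (expi psi + expi (- psi)) +
    u%:C ^+ 2 * e ^+ 2 * (expi psi * expi (- psi))); first by ring.
by rewrite ep es; field; move: u0; rewrite rmorphB rmorph1.
Qed.

(** A pair of conjugate roots outside the sector contributes 2 th and the root
    -1 contributes th, so the winding along the ray only depends on the degree. *)
Lemma turns_along_circle_roots (R : realType) (th : R) (g : {poly R}) :
  0 < th < pi -> 0 < g.[0] -> circle_roots_left_of (cos th) g ->
  turns_along th g 0 ((size g).-1%:R * th).
Proof.
move=> hth; have [m] := ubnP (size g); elim: m g => // m IH g gm g0 hg.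
have gn0 : g != 0 by apply: contraTneq g0 => ->; rewrite horner0 ltxx.
case: (eqVneq (size g) 1%N) => [/eqP/size_poly1P[c cn0 gE]|sg].
  rewrite gE hornerC in g0; rewrite gE size_polyC cn0 mul0r.
  exact: turns_along_const.
have [w gw] : exists w : R[i], root (map_poly (real_complex R) g) w.
  by apply/closed_rootP; rewrite size_map_poly.
have [w1 wth] := hg w gw.
suff step (q d : {poly R}) (D : nat) : g = q * d -> 0 < d.[0] -> size d = D.+2 ->
    turns_along th d 0 (D.+1%:R * th) -> turns_along th g 0 ((size g).-1%:R * th).
  case: (eqVneq (complex.Im w) 0) => wI.
    have wE : w = (-1)%:C.
      case: w {gw} w1 wth wI => a b /= + + b0; rewrite b0 expr0n addr0 => a1 ath.
      congr (_ +i* _); have /eqP := a1; rewrite -subr_eq0 subr_sqr_1.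
      rewrite mulf_eq0 subr_eq0 addr_eq0 => /orP[|]/eqP // aE.
      by move: ath; rewrite aE ltNge cos_le1.
    move: gw; rewrite wE fmorph_root => /factor_theorem[q gE].
    apply: (step q ('X - (-1)%:P) 0%N gE).
    - by rewrite !hornerE.
    - by rewrite size_XsubC.
    - by rewrite mul1r polyCN opprK; exact: turns_along_linear.
  have /dvdpP[q gE] := dvdp_real_quadratic gw wI.
  rewrite w1 in gE; apply: (step q _ 1%N gE).
  - by rewrite !hornerE /=.
  - exact: size_quad.
  - have -> : 2%:R * th = th + th by ring.
    apply: turns_along_quad => //.
    have : 0 < complex.Im w ^+ 2 by rewrite exprn_even_gt0.
    by move: w1; nra.
move=> gE d0 sd td; rewrite gE.
have qd0 : q * d != 0 by rewrite -gE.
have /andP[qn0 _] : (q != 0) && (d != 0) by rewrite -negb_or -mulf_eq0.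
have sqd : (size (q * d)).-1%:R * th = (size q).-1%:R * th + D.+1%:R * th.
  rewrite size_mul ?sd// -?size_poly_gt0 ?sd// -mulrDl -natrD.
  by rewrite -size_poly_gt0 in qn0; case: (size q) qn0 => // k _; rewrite addSn addnS.
rewrite sqd -[X in turns_along _ _ X](addr0 0).
apply: turns_alongM => //; apply: IH.
- move: gm; rewrite gE size_mul ?sd// -?size_poly_gt0 ?sd//.
  by rewrite !addnS/= !ltnS; apply: leq_ltn_trans; rewrite leq_addr.
- by move: g0; rewrite gE hornerM pmulr_lgt0.
- by apply: (@circle_roots_left_of_dvd _ _ _ d); rewrite -gE.
Qed.

(** * Sign patterns of sequences with sinusoidal increments *)

Lemma ivt_open (R : realType) (v : R -> R) (a b y : R) :
  continuous v -> a < b -> v a < y < v b -> exists2 c, a < c < b & v c = y.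
Proof.
move=> cv ab /andP[ay yb].
have [||c] := @IVT R v a b y (ltW ab).
- by apply: continuous_subspaceT.
- by rewrite (min_idPl _) ?(max_idPr _) ?(ltW ay) ?(ltW yb)//; exact/ltW/(lt_trans ay).
rewrite in_itv/= => /andP[ac cb] vc; exists c => //.
rewrite !lt_neqAle ac cb !andbT; apply/andP; split.
  by apply: contraTneq ay => ->; rewrite vc ltxx.
by apply: contraTneq yb => <-; rewrite vc ltxx.
Qed.

Lemma increasing_preimages (R : realType) (v : R -> R) (y : nat -> R) (M : nat) :
  continuous v ->
  (forall m, (m <= M)%N -> v 0 < y m < v 1) ->
  (forall m, (m < M)%N -> y m < y m.+1) ->
  exists u : nat -> R, (forall m, (m <= M)%N -> 0 < u m < 1 /\ v (u m) = y m) /\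
    (forall m, (m < M)%N -> u m < u m.+1).
Proof.
move=> cv; elim: M => [|M IH] hy yi.
  have [c c01 vc] := ivt_open cv ltr01 (hy 0%N isT).
  by exists (fun=> c); split=> // m; rewrite leqn0 => /eqP ->.
have [|m mM|u [hu ui]] := IH.
- by move=> m mM; apply: hy; exact: leqW.
- by apply: yi; exact: leqW.
have [/andP[u0 u1] vu] := hu M (leqnn M).
have [|c /andP[uc c1] vc] := @ivt_open _ v (u M) 1 (y M.+1) cv u1.
  by rewrite vu yi//; have /andP[] := hy M.+1 (leqnn _).
exists (fun m => if (m <= M)%N then u m else c); split=> m mM.
  case: leqP => [mM'|Mm]; first exact: hu.
  have -> : m = M.+1 by apply/eqP; rewrite eqn_leq mM.
  by rewrite c1 (lt_trans u0).
rewrite ltnS in mM; rewrite mM; case: leqP => [mM'|Mm]; last first.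
  exact: ui.
by have -> : m = M by apply/eqP; rewrite eqn_leq mM.
Qed.

Lemma sin_add_natpi (R : realType) (k : nat) (x : R) :
  sin (x + k%:R * pi) = (-1) ^+ k * sin x.
Proof.
elim: k => [|k IH]; first by rewrite mul0r addr0 mul1r.
by rewrite -natr1 mulrDl mul1r addrA sinDpi IH exprS mulN1r mulNr.
Qed.

Lemma sin_sign (R : realType) (k : nat) (x : R) :
  k%:R * pi <= x <= k.+1%:R * pi -> 0 <= (-1) ^+ k * sin x.
Proof.
move=> /andP[kx xk]; rewrite -[x](subrK (k%:R * pi)) sin_add_natpi mulrA -expr2.
rewrite sqrr_sign mul1r sin_ge0_pi// subr_ge0 kx lerBlDr.
by rewrite -natr1 mulrDl mul1r addrC in xk.
Qed.

Section SignThresholds.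
Variables (R : realType) (th : R) (L : nat) (q a : nat -> R).
Hypotheses (th0 : 0 < th) (thpi : th < pi) (q0 : forall i, 0 <= q i).
Hypothesis ha : forall i, a i.+1 - a i = q i * sin (i.+1%:R * th).

Let mono k i j : (i <= j)%N -> k%:R * pi <= i.+1%:R * th ->
  j%:R * th <= k.+1%:R * pi -> (-1) ^+ k * a i <= (-1) ^+ k * a j.
Proof.
elim: j => [|j IH]; first by rewrite leqn0 => /eqP->.
rewrite leq_eqVlt => /predU1P[->//|]; rewrite ltnS => ij ki jk.
have jj : j%:R * th <= j.+1%:R * th by rewrite ler_pM2r// ler_nat.
apply: le_trans (IH ij ki (le_trans jj jk)) _.
rewrite -subr_ge0 -mulrBr ha mulrCA mulr_ge0// sin_sign// jk andbT.
by apply: le_trans ki _; rewrite ler_pM2r// ler_nat ltnS.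
Qed.

(* The increments of (-1)^k a are non-positive on the next block, where
   k.+1 pi <= i th <= k.+2 pi, so one new threshold is enough there: the first
   index at which (-1)^k a is negative, or the end of the block. *)
Let thresholds k : 0 <= a 0%N -> exists es : seq R, [/\ size es = k,
    forall e, e \in es -> 0 <= e /\ e * th <= k.+1%:R * pi &
    forall i, i%:R * th <= k.+1%:R * pi ->
      0 <= (-1) ^+ k * a i * \prod_(e <- es) (i%:R - e)].
Proof.
move=> a0; elim: k => [|k [es [ses ees hes]]].
  exists [::]; split=> // i hi; rewrite big_nil mulr1 mul1r.
  apply: le_trans a0 _; rewrite -[a 0%N]mul1r -[a i]mul1r.
  by rewrite mul1r in hi; apply: (@mono 0); rewrite ?mul0r ?mul1r // ltW.
set top := k.+2%:R * pi / th.
have toppi : top * th = k.+2%:R * pi by rewrite /top divfK // gt_eqF.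
have top0 : 0 <= top by rewrite !mulr_ge0 ?invr_ge0 ?pi_ge0// ltW.
pose P i := (k.+1%:R * pi < i%:R * th) && ((-1) ^+ k * a i < 0).
have [e [e0 etop hlow hup]] : exists e : R, [/\ 0 <= e, e <= top,
    forall i, i%:R < e -> i%:R * th <= k.+1%:R * pi \/ 0 <= (-1) ^+ k * a i &
    forall i, i%:R * th <= k.+2%:R * pi -> e < i%:R ->
      k.+1%:R * pi < i%:R * th /\ (-1) ^+ k * a i <= 0].
  case: (pselect (exists i, P i)) => [exP|nP].
    have [m /andP[km am] mmin] := ex_minnP exP.
    have nP i : (i < m)%N -> i%:R * th <= k.+1%:R * pi \/ 0 <= (-1) ^+ k * a i.
      move=> im; have : ~~ P i by apply/negP => /mmin; rewrite leqNgt im.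
      by rewrite negb_and -!leNgt => /orP.
    exists (Num.min m%:R top); split=> [||i|i itop].
    - by rewrite le_min ler0n.
    - by rewrite ge_min lexx orbT.
    - by rewrite lt_min ltr_nat => /andP[/nP].
    rewrite gt_min => /orP[|]; last first.
      by rewrite -(ltr_pM2r th0) toppi ltNge itop.
    rewrite ltr_nat => mi; have kmi : k.+1%:R * pi < i%:R * th.
      by apply: lt_le_trans km _; rewrite ler_pM2r// ler_nat ltnW.
    split=> //; have := @mono k.+1 m i (ltnW mi) _ itop.
    rewrite !exprS !mulN1r !mulNr lerN2 => h; apply/ltW/(le_lt_trans _ am)/h.
    by apply/ltW/(lt_le_trans km); rewrite ler_pM2r// ler_nat.
  exists top; split=> // i itop.
    case: (leP (i%:R * th) (k.+1%:R * pi)) => ki; [by left|right].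
    by rewrite leNgt; apply/negP => ai; apply: nP; exists i; rewrite /P ki.
  by rewrite -(ltr_pM2r th0) toppi ltNge itop.
exists (e :: es); split=> [|e'|i itop]; first by rewrite /= ses.
  rewrite inE => /predU1P[->|/ees[e'0 e'k]].
    by rewrite e0 -toppi ler_pM2r.
  by split=> //; apply: le_trans e'k _; rewrite ler_pM2r ?pi_gt0// ler_nat.
have es0 : k.+1%:R * pi < i%:R * th -> 0 <= \prod_(e <- es) (i%:R - e).
  move=> ki; rewrite big_seq; apply: prodr_ge0 => e' /ees[_ e'k].
  by rewrite subr_ge0 -(ler_pM2r th0) (le_trans e'k)// ltW.
rewrite big_cons exprS mulN1r.
have -> (x y z t : R) : - x * y * ((z - e) * t) = (e - z) * (x * y * t) by ring.
have [ie|ei|->] := ltgtP i%:R e; last by rewrite subrr mul0r.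
  apply: mulr_ge0; first by rewrite subr_ge0 ltW.
  have [ik|ki] := leP (i%:R * th) (k.+1%:R * pi); first exact: hes.
  by apply: mulr_ge0 (es0 ki); have [|//] := hlow i ie; rewrite leNgt ki.
have [ki ai] := hup i itop ei.
by apply: mulr_le0; [rewrite subr_le0 ltW|apply: mulr_le0_ge0 => //; exact: es0].
Qed.

(** With U = size es, there are only U sign changes although i th runs through
    U.+1 full half-periods: none occurs on the first block, since a starts
    non-negative and increases there, nor on the last one, since a is monotone
    there and ends at 0. *)
Lemma sign_thresholds : (0 < L)%N -> (forall i, (L <= i)%N -> a i = 0) ->
  0 < q L.-1 -> 0 <= a 0%N ->
  exists es : seq R, [/\ (size es).+1%:R * pi <= L%:R * th,
    forall e, e \in es -> 0 <= e &
    forall i, 0 <= (-1) ^+ size es * a i * \prod_(e <- es) (i%:R - e)].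
Proof.
move=> L0 aL qL a0.
have piL : pi <= L%:R * th.
  rewrite leNgt; apply/negP => Lpi; have := ha L.-1.
  rewrite prednK// aL// sub0r => aE.
  have : 0 <= a L.-1.
    apply: le_trans a0 _; have := @mono 0 0 L.-1 (leq0n _).
    rewrite mul0r !mul1r; apply; first exact: ltW.
    by apply/ltW/(le_lt_trans _ Lpi); rewrite ler_pM2r// ler_nat leq_pred.
  rewrite -oppr_le0 aE leNgt mulr_gt0// sin_gt0_pi// Lpi andbT.
  by rewrite mulr_gt0// ltr0n.
set x := L%:R * th / pi.
have x1 : 1 <= x by rewrite ler_pdivlMr ?pi_gt0// mul1r.
pose k := (Num.trunc x).-1.
have kE : k.+1 = Num.trunc x by rewrite prednK// truncn_gt0.
have /andP[kx xk] : k.+1%:R <= x < k.+2%:R.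
  by rewrite kE; apply: truncn_itv; rewrite (le_trans _ x1).
rewrite ler_pdivlMr ?pi_gt0// in kx; rewrite ltr_pdivrMr ?pi_gt0// in xk.
have [es [ses ees hes]] := thresholds k a0.
exists es; rewrite ses; split=> [//|e /ees[]//|i].
have [ik|ki] := leP (i%:R * th) (k.+1%:R * pi); first exact: hes.
have [/aL ->|iL] := leqP L i; first by rewrite mulr0 mul0r.
apply: mulr_ge0.
  have := @mono k.+1 i L (ltnW iL) _ (ltW xk).
  rewrite (aL L)// mulr0 exprS mulN1r mulNr oppr_le0; apply.
  by apply/ltW/(lt_trans ki); rewrite ltr_pM2r// ltr_nat.
rewrite big_seq; apply: prodr_ge0 => e /ees[_ ek].
by rewrite subr_ge0 -(ler_pM2r th0) (le_trans ek)// ltW.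
Qed.

End SignThresholds.

(** * Positivity of the quotient by the pair of zeros nearest to 1 *)

Lemma prodN_seq (R : comNzRingType) (es : seq R) (F : R -> R) :
  \prod_(e <- es) (- F e) = (-1) ^+ size es * \prod_(e <- es) F e.
Proof.
elim: es => [|e es IH]; first by rewrite !big_nil mulr1.
by rewrite !big_cons IH exprS; ring.
Qed.

Lemma Im_sum (R : realType) (I : Type) (s : seq I) (F : I -> R[i]) :
  complex.Im (\sum_(i <- s) F i) = \sum_(i <- s) complex.Im (F i).
Proof. by apply: (big_morph (@complex.Im R)) => // -[a b] [c d]. Qed.

Lemma Im_scale_expi (R : realType) (a x : R) : complex.Im (a%:C * expi x) = a * sin x.
Proof. by rewrite /expi /=; simpc. Qed.

Lemma expiMn (R : realType) (n : nat) (x : R) : expi (n%:R * x) = expi x ^+ n.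
Proof.
elim: n => [|n IH]; first by rewrite mul0r expi0.
by rewrite -natr1 mulrDl mul1r expiD IH exprSr.
Qed.

(** The coefficient of r^i in Im(e^(-i b) (1 - r e^(2 i th)) g(r e^(i th))), see
    [ray_coefP]. *)
Definition ray_coef (R : realType) (th b : R) (g : {poly R}) (i : nat) : R :=
  g`_i * sin (i%:R * th - b) - ('X * g)`_i * sin (i.+1%:R * th - b).

Lemma ray_coefP (R : realType) (th b r : R) (g : {poly R}) :
  \sum_(i < (size g).+1) ray_coef th b g i * r ^+ i =
  complex.Im (expi (- b) * (1 - r%:C * expi (2 * th)) *
              (map_poly (real_complex R) g).[r%:C * expi th]).
Proof.
rewrite horner_coef size_map_poly mulr_sumr Im_sum.
transitivity (\sum_(i < size g) (g`_i * r ^+ i * sin (i%:R * th - b) -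
    g`_i * r ^+ i.+1 * sin (i.+2%:R * th - b))).
  under eq_bigr do rewrite /ray_coef mulrBl.
  rewrite !sumrB; congr (_ - _).
    rewrite big_ord_recr /= [g`_(size g)]nth_default// !mul0r addr0.
    by apply: eq_bigr => i _; ring.
  rewrite big_ord_recl /= coefXM eqxx !mul0r add0r.
  by apply: eq_bigr => i _; rewrite coefXM /= /bump /= add1n; ring.
apply: eq_bigr => i _; rewrite coef_map /= exprMn -!Im_scale_expi.
have -> (x y : R[i]) : complex.Im x - complex.Im y = complex.Im (x - y).
  by case: x y => [a c] [a' c'].
rewrite (expiMn 2) !(expiD (_ * th)) !expiMn; congr (complex.Im _).
by rewrite !rmorphM !rmorphXn /= !exprS; ring.
Qed.

Lemma coef_quad (R : comNzRingType) (a : R) (g : {poly R}) (i : nat) :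
  (quad a * g)`_i = ('X * ('X * g))`_i - a * ('X * g)`_i + g`_i.
Proof.
rewrite mulrDl mulrBl mul1r -scalerAl -['X^2]/('X * 'X) -mulrA.
by rewrite coefD coefB coefZ.
Qed.

Lemma coef_quadS (R : comNzRingType) (a : R) (g : {poly R}) (i : nat) :
  (quad a * g)`_i.+1 = ('X * g)`_i - a * g`_i + g`_i.+1.
Proof. by rewrite coef_quad !coefXM. Qed.

Lemma coef_quad0 (R : comNzRingType) (a : R) (g : {poly R}) :
  (quad a * g)`_0 = g`_0.
Proof. by rewrite coef_quad !coefXM mulr0 subrr add0r. Qed.

(** Since (1 - r)(1 - r e^(2 i th)) g(r e^(i th)) is the value at r e^(i th) of
    (z^2 - 2 cos(th) z + 1) g, the coefficients of that product, times
    values of the sine, are the increments of [ray_coef]. *)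
Lemma ray_coefS (R : realType) (th b : R) (g : {poly R}) (i : nat) :
  ray_coef th b g i.+1 - ray_coef th b g i =
  (quad (2 * cos th) * g)`_i.+1 * sin (i.+1%:R * th - b).
Proof.
rewrite coef_quadS /ray_coef [('X * g)`_i.+1]coefXM /=.
set x := i.+1%:R * th - b.
have -> : i.+2%:R * th - b = x + th by rewrite /x -(natr1 i.+1); ring.
have -> : i%:R * th - b = x - th by rewrite /x -natr1; ring.
by rewrite (sinD x) (sinB x); ring.
Qed.

(** If g_j <= 0, the sequence T starts non-negative at the two equal terms T_j
    and T_(j+1), and [sign_thresholds] applies on both sides of them.  The sign
    change of the sine between j and j + 2 leaves no trace in T, and Descartes'
    rule contradicts the winding of the quotient on the ray. *)
Lemma nearest_zeros_quotient_gt0 (R : realType) (th : R) (g : {poly R}) :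
  0 < th < pi -> g \is monic -> 0 < g`_0 -> circle_roots_left_of (cos th) g ->
  (forall i, 0 <= (quad (2 * cos th) * g)`_i) ->
  forall j, (j < size g)%N -> 0 < g`_j.
Proof.
move=> /andP[th0 thpi] gm g0 hg hp j jg; rewrite ltNge; apply/negP => gj.
set p := (_ * g) in hp; pose b := j.+1%:R * th; pose T := ray_coef th b g.
have TS i : T i.+1 - T i = p`_i.+1 * sin (i.+1%:R * th - b) by exact: ray_coefS.
have sth : 0 < sin th by rewrite sin_gt0_pi ?th0.
have lastg : g`_(size g).-1 = 1 by exact/eqP.
have sg : (0 < size g)%N by apply: leq_ltn_trans jg.
have T0 i : (size g < i)%N -> T i = 0.
  case: i => // i gi; rewrite /T /ray_coef coefXM /= !nth_default ?mul0r ?subr0//.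
  exact: leq_trans gi.
have Tj : T j = - g`_j * sin th.
  rewrite /T /ray_coef subrr sin0 mulr0 subr0 /b -natr1.
  have -> : j%:R * th - (j%:R + 1) * th = - th by ring.
  by rewrite sinN; ring.
have TSj : T j.+1 = T j.
  by apply/eqP; rewrite -subr_eq0 TS /b subrr sin0 mulr0.
have Tj0 : 0 <= T j by rewrite Tj mulr_ge0 ?oppr_ge0// ltW.
have p0 : p`_0 = g`_0 by exact: coef_quad0.
have plast : p`_(size g).+1 = 1.
  rewrite /p coef_quadS coefXM -[_ == 0]negbK -lt0n sg /= lastg.
  by rewrite !nth_default// mulr0 subr0 addr0.
have [eu [hUp eup hu]] : exists es : seq R,
    [/\ (size es).+1%:R * pi <= (size g - j)%:R * th,
    forall e, e \in es -> 0 <= e &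
    forall i, 0 <= (-1) ^+ size es * T (j.+1 + i)%N * \prod_(e <- es) (i%:R - e)].
  apply: (@sign_thresholds _ _ _ (fun i => p`_(j.+2 + i))
    (fun i => T (j.+1 + i)%N)) => //.
  - move=> i; rewrite addnS TS; congr (_ * sin _).
    by rewrite /b -mulrBl -addnS natrD [_ + i.+1%:R]addrC addrK.
  - by rewrite subn_gt0.
  - by move=> i gi; apply: T0; rewrite addSn ltnS -leq_subLR.
  - have -> : (j.+2 + (size g - j).-1)%N = (size g).+1 by lia.
    by rewrite plast.
  - by rewrite addn0 TSj.
have [ed [hDn edp hd]] : exists es : seq R,
    [/\ (size es).+1%:R * pi <= j.+1%:R * th,
    forall e, e \in es -> 0 <= e &
    forall i, 0 <= (-1) ^+ size es * (if (i <= j)%N then T (j - i)%N else 0) *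
      \prod_(e <- es) (i%:R - e)].
  apply: (@sign_thresholds _ _ _ (fun i => if (i <= j)%N then p`_(j - i) else 0)) => //.
  - by move=> i; case: ifP.
  - move=> i; case: (ltngtP i j) => ij.
    + set k := (j - i.+1)%N; have kE : (j - i)%N = k.+1 by rewrite /k subnSK.
      rewrite kE -opprB TS -mulrN -sinN; congr (_ * sin _); rewrite /b.
      have -> : j.+1%:R = k.+1%:R + i.+1%:R :> R by rewrite -natrD; congr _%:R; lia.
      by ring.
    + by rewrite subrr mul0r.
    rewrite ij subnn sub0r /T /ray_coef coefXM /= !mul0r subr0 sub0r sinN p0 /b.
    by rewrite mulrN opprK.
  - by move=> i; rewrite ltnNge => /negbTE ->.
  - by rewrite /= leqnn subnn p0.
  - by rewrite subn0.
pose es := map (fun e => j.+1%:R + e) eu ++ map (fun e => j%:R - e) ed.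
have ses : size es = (size eu + size ed)%N by rewrite size_cat !size_map.
have hes (i : 'I_(size g).+1) :
    0 <= (-1) ^+ size eu * T i * \prod_(e <- es) (i%:R - e).
  rewrite big_cat !big_map /=; case: (leqP j.+1 i) => ij.
    rewrite -(subnKC ij) mulrA; apply: mulr_ge0.
      have := hu (i - j.+1)%N; congr (0 <= _ * _).
      by apply: eq_bigr => e _; rewrite natrD; ring.
    rewrite big_seq; apply: prodr_ge0 => e /edp e0.
    rewrite subnKC// opprB addrCA addr_ge0// subr_ge0 ler_nat ltnW//.
  have := hd (j - i)%N; rewrite leq_subr subKn// => hi.
  have -> : \prod_(e <- ed) (i%:R - (j%:R - e)) =
      (-1) ^+ size ed * \prod_(e <- ed) ((j - i)%:R - e).
    by rewrite -prodN_seq; apply: eq_bigr => e _; rewrite natrB//; ring.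
  have -> : \prod_(e <- eu) (i%:R - (j.+1%:R + e)) =
      (-1) ^+ size eu * \prod_(e <- eu) (j.+1%:R + e - i%:R).
    by rewrite -prodN_seq; apply: eq_bigr => e _; rewrite opprB.
  have -> (s t x y z : R) : s * t * (s * x * (y * z)) = (s * s) * x * (y * t * z) by ring.
  rewrite -expr2 sqrr_sign mul1r; apply: mulr_ge0 hi.
  rewrite big_seq; apply: prodr_ge0 => e /eup e0.
  by rewrite addrAC addr_ge0// subr_ge0 ler_nat ltnW.
have [f tf hf] : turns_along th g 0 ((size g).-1%:R * th).
  by apply: turns_along_circle_roots; rewrite ?th0// horner_coef0.
have /(turnsM tf)[v []] :
    turns (fun u => (1 - u)%:C + u%:C * expi (2 * th - pi)) 0 (2 * th - pi).
  by apply: turns_segment; apply/andP; split; lra.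
rewrite addr0 => cv v0 v1 hv.
(* Arguments at which sin (v - b) = -1 or 1, alternately; the room of a
   half-period left by the thresholds at both ends puts them inside the range
   of the argument v. *)
pose y m := b + (m%:R - (size ed)%:R) * pi - pi / 2.
have vend : v 1 = b + (size g - j)%:R * th - pi.
  rewrite v1 /b natrB 1?ltnW// -(natr1 j) -[in RHS](prednK sg).
  by rewrite -(natr1 (size g).-1); ring.
have ppos := pi_gt0 R.
have [||u [hu01 ui]] := @increasing_preimages _ v y (size es) cv.
- move=> m; rewrite ses vend v0 -(ler_nat R) natrD /y => mM; apply/andP; split.
    have : 0 <= m%:R * pi :> R by apply: mulr_ge0; rewrite ?ler0n ?pi_ge0.
    by move: hDn; rewrite -natr1 /b; nra.
  have : m%:R * pi <= ((size eu)%:R + (size ed)%:R) * pi :> R by rewrite ler_pM2r.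
  by move: hUp; rewrite -natr1; nra.
- by move=> m _; rewrite /y -natr1; nra.
apply: (expsum_descartes hes (s := fun m => ln (u m / (1 - u m)))) => m mM.
  have [/andP[u0 _] _] := hu01 m (ltnW mM).
  have [/andP[_ u1] _] := hu01 m.+1 mM; have uu := ui m mM.
  rewrite ltr_ln ?posrE ?divr_gt0 ?subr_gt0//; [|exact: lt_trans u1|exact: lt_trans uu].
  rewrite ltr_pdivrMr ?subr_gt0; last exact: lt_trans u1.
  rewrite mulrAC ltr_pdivlMr ?subr_gt0//; nra.
have [/andP[u0 u1] vu] := hu01 m mM.
set r := u m / (1 - u m).
have r0 : 0 < r by rewrite divr_gt0 ?subr_gt0.
have -> : expsum (fun i : 'I_(size g).+1 => i%:R) T (ln r) =
    \sum_(i < (size g).+1) T i * r ^+ i.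
  by apply: eq_bigr => i _; congr (_ * _); rewrite expRM_natl lnK// posrE.
have [rho rho0] : exists2 r, 0 < r &
    f (u m) * ((1 - u m)%:C + (u m)%:C * expi (2 * th - pi)) =
    r%:C * expi (v (u m)) by apply: hv; rewrite !ltW.
have uC : (1 - u m)%:C != 0 :> R[i].
  by rewrite (inj_eq (@complexI R)) subr_eq0 gt_eqF.
have -> : (1 - u m)%:C + (u m)%:C * expi (2 * th - pi) =
    (1 - u m)%:C * (1 - r%:C * expi (2 * th)).
  rewrite expiD expiNpi /r rmorphM/= fmorphV/=.
  by field; move: uC; rewrite rmorphB rmorph1.
rewrite hf// vu => fE.
have fI : (1 - u m) ^+ (size g).-1 * (1 - u m) *
    (\sum_(i < (size g).+1) T i * r ^+ i) = rho * sin (y m - b).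
  rewrite ray_coefP -[RHS]Im_scale_expi (expiD (y m)) [rho%:C * _]mulrA -fE.
  have -> (a : R) (z : R[i]) : a * complex.Im z = complex.Im (a%:C * z).
    by case: z => z1 z2 /=; rewrite mul0r addr0.
  by rewrite rmorphM; congr (complex.Im _); ring.
have sy : sin (y m - b) = - ((-1) ^+ size ed * (-1) ^+ m).
  have : (-1) ^+ size ed * sin (y m - b) = - (-1) ^+ m.
    rewrite -sin_add_natpi.
    have -> : y m - b + (size ed)%:R * pi = - (pi / 2) + m%:R * pi by rewrite /y; ring.
    by rewrite sin_add_natpi sinN sin_pihalf mulrN1.
  by move/(congr1 ( *%R ((-1) ^+ size ed))); rewrite mulrA -expr2 sqrr_sign mul1r mulrN.
set S := \sum_(i < _) _ in fI *.
have c0 : 0 < (1 - u m) ^+ (size g).-1 * (1 - u m).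
  by rewrite mulr_gt0 ?exprn_gt0 ?subr_gt0.
rewrite -(pmulr_rlt0 _ c0) mulrCA fI sy ses.
have -> : (-1) ^+ size eu * (-1) ^+ (size eu + size ed - m) *
    (rho * - ((-1) ^+ size ed * (-1) ^+ m)) = - rho * ((-1) ^+ size eu * (-1) ^+ size ed *
    ((-1) ^+ (size eu + size ed - m) * (-1) ^+ m)) by ring.
rewrite -!exprD -ses subnK// addnn -signr_odd odd_double mulr1.
by rewrite oppr_lt0.
Qed.

(** * The orthogonal polynomial and its self-reciprocal combination *)

Lemma orthopolyE (K : fieldType) (n : nat) (c : int -> K) :
  orthopoly n c = \poly_(s < n.+1)
    ((\det (toeplitz n c))^-1 * cofactor (toeplitz n.+1 c) ord_max (inord s)).
Proof.
rewrite poly_def /orthopoly (expand_det_row _ ord_max) scaler_sumr.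
apply: eq_bigr => s _; rewrite !mxE ltnn -scalerA; congr (_ *: _).
rewrite inord_val; suff -> : cofactor (orthopoly_mx n c) ord_max s =
    (cofactor (toeplitz n.+1 c) ord_max s)%:P by rewrite mulrC mul_polyC.
rewrite /cofactor polyCM rmorphXn rmorphN1 -det_map_mx; congr (_ * \det _).
apply/matrixP => i j; rewrite !mxE.
by rewrite /= {1}/bump [(n <= i)%N]leqNgt ltn_ord /= add0n ltn_ord.
Qed.

Lemma coef_orthopoly (K : fieldType) (n : nat) (c : int -> K) (s : 'I_n.+1) :
  (orthopoly n c)`_s =
    (\det (toeplitz n c))^-1 * cofactor (toeplitz n.+1 c) ord_max s.
Proof. by rewrite orthopolyE coef_poly ltn_ord inord_val. Qed.

(** Replacing the last row of the Toeplitz matrix by the row of index m makes its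
    determinant vanish. *)
Lemma orthopoly_orth (K : fieldType) (n : nat) (c : int -> K) (m : nat) :
  (m < n)%N -> \sum_(s < n.+1) c (m%:Z - s%:Z) * (orthopoly n c)`_s = 0.
Proof.
move=> mn; have mn' : (m < n.+1)%N by exact: ltnW.
have /matrixP/(_ (Ordinal mn') ord_max) := mul_mx_adj (toeplitz n.+1 c).
rewrite !mxE -val_eqE /= (ltn_eqF mn) mulr0n => /(congr1 ( *%R (\det (toeplitz n c))^-1)).
rewrite mulr0 mulr_sumr => h; rewrite -[RHS]h; apply: eq_bigr => s _.
by rewrite coef_orthopoly !mxE mulrCA.
Qed.

Lemma orthopoly_lead (K : fieldType) (n : nat) (c : int -> K) :
  \det (toeplitz n c) != 0 -> (orthopoly n c)`_n = 1.
Proof.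
move=> d0; rewrite (coef_orthopoly c ord_max) /cofactor addnn -signr_odd odd_double mul1r.
suff -> : \det (row' ord_max (col' ord_max (toeplitz n.+1 c))) = \det (toeplitz n c).
  by rewrite mulVf.
congr (\det _); apply/matrixP => i j; rewrite !mxE /= /bump.
by rewrite [(n <= i)%N]leqNgt [(n <= j)%N]leqNgt !ltn_ord.
Qed.

Lemma orthopoly_map (R : realType) (n : nat) (c : int -> R) :
  orthopoly n (fun j => (c j)%:C) = map_poly (real_complex R) (orthopoly n c).
Proof.
have toepC m : toeplitz m (fun j => (c j)%:C) = map_mx (real_complex R) (toeplitz m c).
  by apply/matrixP => i j; rewrite !mxE.
apply/polyP => i; rewrite coef_map !orthopolyE !coef_poly.
case: ifP => // _.
by rewrite !toepC det_map_mx cofactor_map_mx [RHS]rmorphM fmorphV.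
Qed.

Definition twist (R : pzRingType) (c : int -> R) (j : int) : R := (-1) ^+ `|j|%N * c j.

(** (-1)^n Q_n(-z), the monic orthogonal polynomial for [twist c].  Its
    coefficients are quotients of minors, without sign. *)
Definition reflected_orthopoly (R : fieldType) (n : nat) (c : int -> R) : {poly R} :=
  \poly_(i < n.+1) ((-1) ^+ (n + i) * (orthopoly n c)`_i).

(** The real form z q + q^* of (-1)^(n+1) P(-z), with q the previous
    polynomial; see [flippoly_paraorthopoly]. *)
Definition parapoly (R : fieldType) (n : nat) (c : int -> R) : {poly R} :=
  'X * reflected_orthopoly n c + \poly_(i < n.+1) (reflected_orthopoly n c)`_(n - i).

Lemma coef_compNX (R : comNzRingType) (p : {poly R}) (i : nat) :
  (p \Po (- 'X))`_i = (-1) ^+ i * p`_i.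
Proof.
have cE (k : nat) : ((- 'X) ^+ k)`_i = (-1) ^+ k * (i == k)%:R :> R.
  by rewrite -scaleN1r exprZn coefZ coefXn.
rewrite coef_comp_poly; case: (ltnP i (size p)) => ip.
  rewrite (bigD1 (Ordinal ip))//= cE eqxx mulr1 big1 ?addr0 1?mulrC// => k ki.
  by rewrite cE -val_eqE/= eq_sym in ki *; rewrite (negbTE ki) !mulr0.
rewrite nth_default// mulr0 big1// => k _; rewrite cE.
by rewrite gtn_eqF ?mulr0// (leq_trans (ltn_ord k)).
Qed.

Lemma coef_parapoly (R : fieldType) (n : nat) (c : int -> R) (i : nat) :
  (parapoly n c)`_i = (if (0 < i <= n.+1)%N then (reflected_orthopoly n c)`_i.-1 else 0) +
                      (if (i <= n)%N then (reflected_orthopoly n c)`_(n - i) else 0).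
Proof.
rewrite coefD coefXM coef_poly ltnS; congr (_ + _).
case: i => //= i; rewrite coef_poly; case: ltnP => // ni.
Qed.

Lemma flippoly_paraorthopoly (R : realType) (n : nat) (c : int -> R) :
  flippoly n (paraorthopoly n (fun j => (c j)%:C) ((-1) ^+ n)) =
  map_poly (real_complex R) (parapoly n c).
Proof.
have sQ : (size (orthopoly n c) <= n.+1)%N.
  by rewrite orthopolyE; exact: size_poly.
apply/polyP => i; rewrite /flippoly /paraorthopoly /revpoly orthopoly_map.
rewrite coefZ coef_compNX coefB coefZ [RHS]coef_map coef_parapoly coefXM.
rewrite [(\poly_(_ < _) _)`_i]coef_poly !coef_map /=.
have cb : ((-1 : R[i]) ^+ n)^* = ((-1) ^+ n)%:C.
  by rewrite rmorphXn rmorphN1 rmorphXn rmorphN1.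
have cr (x : R) : (x%:C)^* = x%:C by rewrite -[LHS]/(x%:C^*%C) conjc_real.
rewrite cb cr ltnS; set Q := orthopoly n c in sQ *.
transitivity ((-1) ^+ n.+1 * ((-1) ^+ i * ((if i == 0%N then 0 else Q`_i.-1) -
    (-1) ^+ n * (if (i <= n)%N then Q`_(n - i) else 0))))%:C.
  rewrite !(rmorphM, rmorphB, rmorphXn, rmorphN1) /=.
  by do 2!case: ifP => _; rewrite ?rmorph0.
congr (_%:C); rewrite /reflected_orthopoly.
have sgn k : (-1) ^+ k * (-1) ^+ k = 1 :> R by rewrite -expr2 sqrr_sign.
case: i => [|i] /=.
  rewrite subn0 add0r coef_poly ltnSn exprD expr0 exprS; ring.
rewrite ltnS; have [ni|iN|->] := ltngtP i n.
- rewrite !coef_poly !ltnS (ltnW ni) leq_subr.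
  have eE : (-1) ^+ (n - i.+1) = (-1) ^+ n * (-1) ^+ i.+1 :> R.
    by rewrite -[in RHS](subnK ni) exprD -mulrA sgn mulr1.
  rewrite !exprD eE !exprS;   ring.
- by rewrite nth_default ?(leq_trans sQ)// mulr0 subr0 !mulr0 addr0.
- rewrite coef_poly ltnSn mulr0 subr0 addr0 !exprS exprD; ring.
Qed.

(** Orthogonality to z, ..., z^n for the functional with moments [c]; the lowest
    and the highest powers are left out. *)
Definition para_orth (R : nzRingType) (n : nat) (c : int -> R) (p : {poly R}) : Prop :=
  forall m, (m < n)%N -> \sum_(j < n.+2) c (m.+1%:Z - j%:Z) * p`_j = 0.

Lemma sign_absz_sub (R : nzRingType) (i j : nat) :
  (-1) ^+ `|i%:Z - j%:Z|%N = (-1) ^+ (i + j) :> R.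
Proof.
rewrite -signr_odd -[RHS]signr_odd oddD; congr (_ ^+ (nat_of_bool _)).
have [ij|ji] := leqP i j.
  have -> : `|i%:Z - j%:Z|%N = (j - i)%N by lia.
  by rewrite oddB// addbC.
have -> : `|i%:Z - j%:Z|%N = (i - j)%N by lia.
by rewrite oddB// ltnW.
Qed.

Lemma parapoly_orth (R : fieldType) (n : nat) (c : int -> R) :
  (forall j : int, (`|j| <= n)%N -> c (- j) = c j) ->
  para_orth n (twist c) (parapoly n c).
Proof.
move=> cs m mn; rewrite /parapoly.
have q0 k : (k < n)%N ->
    \sum_(j < n.+1) twist c (k%:Z - j%:Z) * (reflected_orthopoly n c)`_j = 0.
  move=> kn; transitivity ((-1) ^+ (n + k) *
      \sum_(s < n.+1) c (k%:Z - s%:Z) * (orthopoly n c)`_s).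
    rewrite mulr_sumr; apply: eq_bigr => s _.
    rewrite coef_poly ltn_ord /twist sign_absz_sub !exprD.
    set e := (-1) ^+ s.
    transitivity (e * e * ((-1) ^+ n * (-1) ^+ k *
        (c (k%:Z - s%:Z) * (orthopoly n c)`_s))); first by ring.
    by rewrite -expr2 sqrr_sign mul1r.
  by rewrite orthopoly_orth ?mulr0.
under eq_bigr do rewrite coefD mulrDr.
rewrite big_split /= [X in X + _]big_ord_recl coefXM mulr0 add0r.
rewrite [X in X + _](_ : _ = 0) ?add0r; last first.
  rewrite -[RHS](q0 m mn); apply: eq_bigr => j _.
  by rewrite coefXM /=; congr (twist c _ * _); rewrite /bump /=; lia.
rewrite big_ord_recr /= [X in _ * X]coef_poly ltnn mulr0 addr0.
rewrite -[RHS](q0 (n - m.+1)%N) ?ltn_subrL// ?(leq_trans _ mn)//.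
rewrite (reindex_inj rev_ord_inj) /=; apply: eq_bigr => j _.
rewrite coef_poly; have jn := ltn_ord j; rewrite ifT; last by lia.
congr (_ * _`_ _); last by lia.
rewrite -[in RHS]opprB /twist abszN cs; last by lia.
by congr (_ * c _); [congr (_ ^+ _)|]; lia.
Qed.

Lemma parapoly_palin (R : fieldType) (n : nat) (c : int -> R) (i : nat) :
  (i <= n.+1)%N -> (parapoly n c)`_(n.+1 - i) = (parapoly n c)`_i.
Proof.
move=> ni; rewrite !coef_parapoly addrC; congr (_ + _).
  case: i ni => [|i] ni; first by rewrite subn0 ltnn.
  by rewrite subSS leq_subr ltnS ni /= subKn.
have -> : (0 < n.+1 - i <= n.+1)%N = (i <= n)%N by rewrite subn_gt0 leq_subr andbT ltnS.
by case: leqP => // i_n; rewrite subSn.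
Qed.

Lemma size_parapoly (R : fieldType) (n : nat) (c : int -> R) :
  (size (parapoly n c) <= n.+2)%N.
Proof.
apply/leq_sizeP => i ni; rewrite coef_parapoly !ifF ?addr0//.
  by rewrite leqNgt (ltnW ni).
by rewrite [(i <= _)%N]leqNgt ni andbF.
Qed.

Lemma parapoly_coef0 (R : fieldType) (n : nat) (c : int -> R) :
  \det (toeplitz n c) != 0 -> (parapoly n c)`_0 = 1.
Proof.
move=> d0; rewrite coef_parapoly add0r subn0 coef_poly ltnSn orthopoly_lead//.
by rewrite mulr1 addnn -signr_odd odd_double.
Qed.

(** The coefficients of q are minors of the Toeplitz matrix divided by a leading
    minor: this is where total non-negativity enters. *)
Lemma parapoly_ge0 (R : realFieldType) (n : nat) (c : int -> R) (i : nat) :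
  totally_nonneg (toeplitz n.+1 c) -> 0 <= (parapoly n c)`_i.
Proof.
move=> tn.
have lift_mono (h : 'I_n.+1) : {homo lift h : i j / (i < j)%N}.
  by move=> a b ab; rewrite /= ltnNge leq_bump2 -ltnNge.
have d0 : 0 <= \det (toeplitz n c).
  have := tn n _ _ (lift_mono ord_max) (lift_mono ord_max).
  congr (0 <= \det _); apply/matrixP => a b; rewrite !mxE /= /bump.
  by rewrite [(n <= a)%N]leqNgt [(n <= b)%N]leqNgt !ltn_ord.
have q0 k : 0 <= (reflected_orthopoly n c)`_k.
  rewrite coef_poly; case: ltnP => // kn.
  rewrite (coef_orthopoly c (Ordinal kn)) /cofactor.
  have -> (x y z : R) : x * (y * (x * z)) = x * x * (y * z) by ring.
  rewrite -expr2 sqrr_sign mul1r.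
  rewrite mulr_ge0 ?invr_ge0//.
  have := tn n _ _ (lift_mono ord_max) (lift_mono (Ordinal kn)).
  by congr (0 <= \det _); apply/matrixP => a b; rewrite !mxE.
by rewrite coef_parapoly addr_ge0//; case: ifP.
Qed.

(** * Zeros of a self-reciprocal polynomial with the orthogonality of z q + q^* *)

Definition toep_form (R : pzRingType) (n : nat) (c : int -> R) (a : nat -> R) : R :=
  \sum_(i < n) a i * \sum_(j < n) c (i%:Z - j%:Z) * a j.

Definition posform (R : numDomainType) (n : nat) (c : int -> R) : Prop :=
  forall a : nat -> R, (exists2 i, (i < n)%N & a i != 0) -> 0 < toep_form n c a.

Lemma posdef_posform (R : numDomainType) (n : nat) (c : int -> R) :
  posdef (toeplitz n c) -> posform n c.
Proof.
move=> pd a [k kn ak]; pose x : 'cV[R]_n := \col_i a i.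
have /pd : x != 0.
  by apply: contra ak => /eqP/matrixP/(_ (Ordinal kn) 0); rewrite !mxE => ->.
congr (0 < _); rewrite -mulmxA !mxE; apply: eq_bigr => i _; rewrite !mxE.
by congr (_ * _); apply: eq_bigr => j _; rewrite !mxE.
Qed.

Lemma posform_twist (R : numDomainType) (n : nat) (c : int -> R) :
  posform n c -> posform n (twist c).
Proof.
move=> pd a [k kn ak]; have := pd (fun i => (-1) ^+ i * a i).
have -> : toep_form n c (fun i => (-1) ^+ i * a i) = toep_form n (twist c) a.
  apply: eq_bigr => i _; rewrite !mulr_sumr; apply: eq_bigr => j _.
  by rewrite /twist sign_absz_sub exprD; ring.
by apply; exists k => //; rewrite mulf_neq0// signr_eq0.
Qed.

Lemma toep_form_zero_last (R : numDomainType) (n : nat) (c : int -> R) (a : nat -> R) :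
  a n = 0 -> toep_form n.+1 c a = toep_form n c a.
Proof.
move=> an; rewrite /toep_form big_ord_recr /= an mul0r addr0; apply: eq_bigr => i _.
by rewrite big_ord_recr /= an mulr0 addr0.
Qed.

Lemma posformW (R : numDomainType) (n : nat) (c : int -> R) :
  posform n.+1 c -> posform n c.
Proof.
move=> pd a [k kn ak]; have := pd (fun i => if (i < n)%N then a i else 0).
rewrite toep_form_zero_last ?ltnn// => h.
have -> : toep_form n c a = toep_form n c (fun i => if (i < n)%N then a i else 0).
  apply: eq_bigr => i _; rewrite ltn_ord; congr (_ * _).
  by apply: eq_bigr => j _; rewrite ltn_ord.
by apply: h; exists k; [exact: ltnW|rewrite kn].
Qed.

Lemma posform_det (R : numFieldType) (n : nat) (c : int -> R) :
  posform n c -> \det (toeplitz n c) != 0.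
Proof.
move=> pd; apply/negP; rewrite -det_tr => /det0P[v v0 vT].
case: n => [|n] in c pd v v0 vT *; first by rewrite [v]thinmx0 eqxx in v0.
have [i vi] : exists i, v 0 i != 0 by exact/rV0Pn.
have := pd (fun i => v 0 (inord i)).
rewrite /toep_form big1 ?ltxx => [|k _].
  by move=> h; have : false by apply: h; exists i; rewrite ?inord_val.
rewrite (_ : \sum_(j < _) _ = 0) ?mulr0//.
have /matrixP/(_ 0 k) := vT; rewrite !mxE => h; rewrite -[RHS]h; apply: eq_bigr => j _.
by rewrite !mxE inord_val mulrC.
Qed.

Lemma posform_complex (R : realType) (n : nat) (c : int -> R) (a : nat -> R[i]) :
  posform n c -> (exists2 i, (i < n)%N & a i != 0) ->
  \sum_(i < n) (a i)^*%C * (\sum_(j < n) (c (i%:Z - j%:Z))%:C * a j) != 0.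
Proof.
move=> pd [k kn ak]; apply/eqP => /(congr1 (@complex.Re R)).
have Re_sum (I : Type) (s : seq I) (F : I -> R[i]) :
    complex.Re (\sum_(i <- s) F i) = \sum_(i <- s) complex.Re (F i).
  by apply: (big_morph (@complex.Re R)) => // -[x y] [z t].
have -> : complex.Re (\sum_(i < n) (a i)^*%C * (\sum_(j < n) (c (i%:Z - j%:Z))%:C * a j)) =
   toep_form n c (fun i => complex.Re (a i)) + toep_form n c (fun i => complex.Im (a i)).
  rewrite Re_sum -big_split /=; apply: eq_bigr => i _.
  rewrite !mulr_sumr -big_split Re_sum /=; apply: eq_bigr => j _.
  by case: (a i) (a j) => x y [z t] /=; ring.
have form0 (x : nat -> R) : 0 <= toep_form n c x.
  case: (pselect (exists2 i, (i < n)%N & x i != 0)) => [/pd/ltW//|nx].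
  rewrite /toep_form big1// => i _; rewrite (_ : x i = 0) ?mul0r//.
  by apply/eqP; apply/negPn/negP => xi; apply: nx; exists i.
move/eqP; rewrite /= paddr_eq0// => /andP[/eqP r0 /eqP i0].
move: ak; rewrite eq_complex negb_and => /orP[] ak.
  have := pd (fun i => complex.Re (a i)); rewrite r0 ltxx => h.
  by have : false by apply: h; exists k.
have := pd (fun i => complex.Im (a i)); rewrite i0 ltxx => h.
by have : false by apply: h; exists k.
Qed.

(** On the unit circle z - 1/conj(a) = - (z / conj(a)) conj(z - a), so the
    orthogonality of p to z h would give the norm 0 to (z - a) h.  Reflected
    pairs of zeros off the circle and double zeros on it are both of this form. *)
Lemma no_reflected_pair (R : realType) (n : nat) (c : int -> R) (p : {poly R})
    (a : R[i]) (h : {poly R[i]}) :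
  posform n.+1 c -> para_orth n c p -> a != 0 -> h != 0 -> (size h <= n)%N ->
  map_poly (real_complex R) p <> ('X - a%:P) * (('X - ((a^*%C)^-1)%:P) * h).
Proof.
move=> pd po a0 h0 sh pE; set b := (a^*%C)^-1 in pE.
pose f := ('X - a%:P) * h; pose Phi m := \sum_(j < n.+1) (c (m%:Z - j%:Z))%:C * f`_j.
have f0 : f != 0 by rewrite mulf_neq0// polyXsubC_eq0.
have sf : (size f <= n.+1)%N by rewrite size_monicM ?monicXsubC// size_XsubC.
(* Orthogonality turns the factor z - b into a recurrence for the products of
   z^m with f. *)
have PhiS m : (m < n)%N -> Phi m = b * Phi m.+1.
  move=> mn; apply/eqP; rewrite -subr_eq0; apply/eqP.
  transitivity (\sum_(j < n.+2) (c (m.+1%:Z - j%:Z) * p`_j)%:C); last first.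
    by rewrite -(rmorph_sum (real_complex R)) po.
  have pj j : (p`_j)%:C = ('X * f)`_j - b * f`_j.
    have -> : (p`_j)%:C = (map_poly (real_complex R) p)`_j by rewrite coef_map.
    by rewrite pE mulrCA -/f mulrBl coefB coefCM.
  under eq_bigr do rewrite rmorphM /= pj mulrBr.
  rewrite sumrB; congr (_ - _).
    rewrite big_ord_recl /= coefXM mulr0 add0r; apply: eq_bigr => j _.
    by rewrite coefXM /= /bump /= add1n; congr ((c _)%:C * _); lia.
  rewrite big_ord_recr /= [f`_n.+1]nth_default// !mulr0 addr0 mulr_sumr.
  by apply: eq_bigr => j _; rewrite mulrCA.
have /eqP[] : \sum_(i < n.+1) (f`_i)^*%C * Phi i != 0.
  apply: (@posform_complex R n.+1 c (fun i => f`_i) pd).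
  exists (size f).-1; last by rewrite -lead_coefE lead_coef_eq0.
  by rewrite prednK ?size_poly_gt0.
have fj j : (f`_j)^*%C = (('X * h)`_j)^*%C - a^*%C * (h`_j)^*%C.
  by rewrite /f mulrBl coefB coefCM rmorphB rmorphM.
under eq_bigr do rewrite fj mulrBl.
rewrite sumrB big_ord_recl coefXM rmorph0 mul0r add0r.
rewrite [X in _ - X]big_ord_recr /= [h`_n]nth_default// rmorph0 mulr0 mul0r addr0.
rewrite -sumrB big1// => j _; rewrite coefXM /= /bump /= add1n -!/(Phi _).
by rewrite (PhiS j)// /b add0n; field; rewrite conjc_eq0.
Qed.

Section SelfReciprocal.
Variables (R : realType) (n : nat) (c : int -> R) (p : {poly R}).
Hypotheses (pd : posform n.+1 c) (po : para_orth n c p) (sp : (size p <= n.+2)%N).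
Hypothesis palin : forall i, (i <= n.+1)%N -> p`_(n.+1 - i) = p`_i.
Hypothesis p0 : p`_0 = 1.
Let pC := map_poly (real_complex R) p.

Let pC0 : pC.[0] = 1.
Proof. by rewrite horner_coef0 coef_map p0. Qed.

Let pCn0 : pC != 0.
Proof.
apply/eqP => h; have := pC0; rewrite h horner0 => /eqP.
by rewrite eq_sym oner_eq0.
Qed.

Let root_neq0 a : root pC a -> a != 0.
Proof. by apply: contraTneq => ->; rewrite /root pC0 oner_eq0. Qed.

Lemma size_self_reciprocal : size p = n.+2.
Proof.
apply/eqP; rewrite eqn_leq sp /= ltnNge.
apply/negP => /leq_sizeP/(_ n.+1 (leqnn _)).
by rewrite -(subn0 n.+1) palin// p0 => /eqP; rewrite oner_eq0.
Qed.

Let size_pC : size pC = n.+2.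
Proof. by rewrite size_map_poly size_self_reciprocal. Qed.

Lemma palin_root_inv a : root pC a -> root pC a^-1.
Proof.
move=> pa; have a0 := root_neq0 pa.
suff -> : pC = \poly_(i < n.+2) pC`_(n.+1 - i).
  rewrite /root horner_poly.
  have -> : \sum_(i < n.+2) pC`_(n.+1 - i) * a^-1 ^+ i = a ^- n.+1 * pC.[a].
    rewrite horner_coef size_pC mulr_sumr (reindex_inj rev_ord_inj) /=.
    apply: eq_bigr => i _.
    rewrite (_ : n.+1 - (n.+2 - i.+1) = i)%N; last by have := ltn_ord i; lia.
    rewrite subSS mulrCA; congr (_ * _).
    rewrite exprVn -[X in a ^- X](subnK (leq_ord i)).
    by rewrite exprD invfM -mulrA mulVf ?mulr1// expf_neq0.
  by move: pa; rewrite /root => /eqP ->; rewrite mulr0.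
apply/polyP => i; rewrite coef_poly; case: ltnP => ni.
  by rewrite /pC !coef_map palin.
by rewrite nth_default// size_pC.
Qed.

Lemma root_reflected a : root pC a -> root pC (a^*%C)^-1.
Proof. by move=> pa; apply: palin_root_inv; exact: root_conj. Qed.

Let size_double_quotient a b h : pC = ('X - a%:P) * (('X - b%:P) * h) ->
  h != 0 /\ (size h <= n)%N.
Proof.
move=> hE; have h0 : h != 0 by apply: contra_neq pCn0 => h0; rewrite hE h0 !mulr0.
have /eqP := size_pC; rewrite hE !size_monicM ?monicXsubC ?mulf_neq0 ?polyXsubC_eq0//.
by rewrite !size_XsubC !addSn /= !eqSS add0n => /eqP ->.
Qed.

Lemma root_circle a : root pC a -> complex.Re a ^+ 2 + complex.Im a ^+ 2 = 1.
Proof.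
move=> pa; have a0 := root_neq0 pa; apply: contrapT => na.
have : \prod_(w <- [:: a; (a^*%C)^-1]) ('X - w%:P) %| pC.
  apply: uniq_roots_dvdp; first by rewrite /= pa root_reflected.
  rewrite uniq_rootsE /= inE andbT; apply/negP => /eqP aE; apply: na.
  have : a * a^*%C = 1 by rewrite {1}aE mulVf// conjc_eq0.
  case: (a) => x y /(congr1 (@complex.Re R)) /= <-; ring.
rewrite !big_cons big_nil mulr1 => /dvdpP[h]; rewrite mulrC -mulrA => hE.
have [h0 sh] := size_double_quotient hE.
exact: (no_reflected_pair pd po a0 h0 sh hE).
Qed.

Lemma root_simple a h : root pC a -> pC <> ('X - a%:P) * (('X - a%:P) * h).
Proof.
move=> pa hE; have a0 := root_neq0 pa.
have aa : (a^*%C)^-1 = a.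
  have := root_circle pa; case: a {pa hE} a0 => x y a0 xy.
  apply: (mulIf (x := (x +i* y)^*%C)); first by rewrite conjc_eq0.
  rewrite mulVf ?conjc_eq0//.
  have -> : (x +i* y) * (x +i* y)^*%C = (x ^+ 2 + y ^+ 2)%:C.
    by simpc; congr (_ +i* _); ring.
  by rewrite xy.
have [h0 sh] := size_double_quotient hE.
by apply: (no_reflected_pair pd po a0 h0 sh); rewrite aa.
Qed.

(** The difference of both sides only involves z, ..., z^n, to which it is
    orthogonal. *)
Lemma self_reciprocal_unique (f : {poly R}) : para_orth n c f -> (size f <= n.+2)%N ->
  (forall i, (i <= n.+1)%N -> f`_(n.+1 - i) = f`_i) -> f = f`_0 *: p.
Proof.
move=> fo sf fp; apply/eqP; rewrite -subr_eq0; set g := _ - _.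
have g0 : g`_0 = 0 by rewrite coefB coefZ p0 mulr1 subrr.
have gn : g`_n.+1 = 0.
  by rewrite coefB coefZ -[n.+1]subn0 fp// palin// p0 mulr1 subrr.
have go m : (m < n)%N -> \sum_(j < n) c (m%:Z - j%:Z) * g`_j.+1 = 0.
  move=> mn; transitivity (\sum_(j < n.+2) c (m.+1%:Z - j%:Z) * g`_j).
    rewrite big_ord_recl g0 mulr0 add0r big_ord_recr /= [g`__]gn mulr0 addr0.
    by apply: eq_bigr => j _; rewrite /bump /= add1n; congr (c _ * _); lia.
  under eq_bigr do rewrite coefB coefZ mulrBr mulrCA.
  by rewrite sumrB -mulr_sumr fo// po// mulr0 subrr.
have gz k : (k < n)%N -> g`_k.+1 = 0.
  move=> kn; apply/eqP/negPn/negP => gk; have := posformW pd (a := fun i => g`_i.+1).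
  rewrite /toep_form big1 ?ltxx => [h|i _]; last by rewrite go ?mulr0.
  by have : false by apply: h; exists k.
apply/eqP/polyP => -[|i]; rewrite coef0//; have [/gz//|] := ltnP i n.
rewrite leq_eqVlt => /predU1P[<-//|ni]; rewrite coefB coefZ [f`_i.+1]nth_default.
  by rewrite [p`_i.+1]nth_default ?mulr0 ?subrr//; exact: leq_trans sp _.
exact: leq_trans sf _.
Qed.
End SelfReciprocal.

(** * The largest eigenvalue of a symmetric pencil on invariant vectors *)

Lemma continuous_bigsum (T : topologicalType) (R : realType) (I : Type)
    (s : seq I) (f : I -> T -> R) :
  (forall i, continuous (f i)) -> continuous (fun x => \sum_(i <- s) f i x).
Proof.
move=> fc; elim: s => [|i s IH] x.
  by under eq_fun do rewrite big_nil; exact: cvg_cst.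
under eq_fun do rewrite big_cons.
by apply: cvgD; [exact: fc|exact: IH].
Qed.

Definition qform (R : pzRingType) (n : nat) (A : 'M[R]_n) (x : 'rV[R]_n) : R :=
  (x *m A *m x^T) 0 0.

Lemma qform_continuous (R : realType) (n : nat) (A : 'M[R]_n) :
  continuous (qform A).
Proof.
have -> : qform A = fun x => \sum_i (\sum_j x 0 j * A j i) * x 0 i.
  by apply/funext => x; rewrite /qform mxE; apply: eq_bigr => i _; rewrite !mxE.
have lin i : continuous (fun x : 'rV[R]_n => \sum_j x 0 j * A j i).
  apply: continuous_bigsum => j x.
  apply: (@continuousM _ _ (fun x : 'rV[R]_n => x 0 j) (cst (A j i)) x).
    exact: coord_continuous.
  exact: cst_continuous.
apply: continuous_bigsum => i x.
apply: (@continuousM _ _ _ (fun x : 'rV[R]_n => x 0 i) x); first exact: lin.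
exact: coord_continuous.
Qed.

Lemma qformB (R : comPzRingType) (n : nat) (A B : 'M[R]_n) (l : R) (x : 'rV[R]_n) :
  qform (A - l *: B) x = qform A x - l * qform B x.
Proof. by rewrite /qform mulmxBr -scalemxAr mulmxBl -scalemxAl !mxE. Qed.

Lemma qformZ (R : comPzRingType) (n : nat) (A : 'M[R]_n) (l : R) (x : 'rV[R]_n) :
  qform A (l *: x) = l ^+ 2 * qform A x.
Proof. by rewrite /qform linearZ /= -!scalemxAl -scalemxAr !mxE expr2 mulrA. Qed.

Lemma qformD (R : comPzRingType) (n : nat) (A : 'M[R]_n) (e : R) (x y : 'rV[R]_n) :
  A^T = A ->
  qform A (x + e *: y) = qform A x + 2 * e * (x *m A *m y^T) 0 0 + e ^+ 2 * qform A y.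
Proof.
move=> As.
have AE : (y *m A *m x^T) 0 0 = (x *m A *m y^T) 0 0.
  have -> : y *m A *m x^T = (x *m A *m y^T)^T by rewrite !trmx_mul trmxK As mulmxA.
  by rewrite mxE.
rewrite /qform linearD linearZ /= !mulmxDl !mulmxDr -!scalemxAl -!scalemxAr.
have E (u v w t : 'M[R]_1) : (u + v + (w + t)) 0 0 = u 0 0 + v 0 0 + (w 0 0 + t 0 0).
  by rewrite !mxE.
have EZ (u : 'M[R]_1) : (e *: u) 0 0 = e * u 0 0 by rewrite mxE.
by rewrite E !EZ AE; ring.
Qed.

Section InvariantEigenvector.
Variables (R : realType) (n : nat) (A B : 'M[R]_n.+1) (sg : 'I_n.+1 -> 'I_n.+1).
Hypotheses (As : A^T = A) (Bs : B^T = B) (sgK : involutive sg).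
Hypothesis Asg : forall i j, A (sg i) (sg j) = A i j.
Hypothesis Bsg : forall i j, B (sg i) (sg j) = B i j.
Hypothesis Bpos : forall x, x != 0 -> 0 < qform B x.

Let inv (x : 'rV[R]_n.+1) := forall i, x 0 (sg i) = x 0 i.

Let sphere : set 'rV[R]_n.+1 := [set x | inv x /\ `|x| = 1].

Let sphere_compact : compact sphere.
Proof.
apply: bounded_closed_compact.
  by exists 1; split=> // M M1 x [_ x1]; rewrite /= x1 ltW.
have -> : sphere =
    (\bigcap_(i in setT) [set x : 'rV[R]_n.+1 | x 0 (sg i) - x 0 i = 0]) `&`
    [set x | `|x| = 1].
  apply/seteqP; split=> [x [xi x1]|x [xi x1]]; split=> //.
    by move=> i _ /=; rewrite xi subrr.
  by move=> i; apply/eqP; rewrite -subr_eq0; apply/eqP; exact: xi.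
apply: closedI.
  apply: closed_bigI => i _.
  apply: (@preimage_closed _ _ (fun x : 'rV[R]_n.+1 => x 0 (sg i) - x 0 i) [set x | x = 0]).
    move=> x _; apply: (@continuousB _ _ _ (fun x : 'rV[R]_n.+1 => x 0 (sg i))
      (fun x : 'rV[R]_n.+1 => x 0 i) x); exact: coord_continuous.
  exact: closed_eq.
apply: (@preimage_closed _ _ (fun x : 'rV[R]_n.+1 => `|x|) [set x | x = 1]).
  by move=> x _; exact: norm_continuous.
exact: closed_eq.
Qed.

(** The quotient of the two forms attains its maximum l on the compact unit
    sphere of the invariant vectors.  The row k = h (A - l B) is again invariant,
    and the first variation of A - l B at h in the direction k is 2 |k|^2, so
    k = 0: the eigenvector equation holds in all directions, not only in the
    invariant ones. *)
Lemma invariant_eigenvector : exists (l : R) (h : 'rV[R]_n.+1),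
  [/\ h != 0, inv h, h *m (A - l *: B) = 0 &
      forall x, inv x -> qform A x <= l * qform B x].
Proof.
pose f x := qform A x / qform B x.
have sphere0 x : sphere x -> x != 0.
  by move=> [_ x1]; rewrite -normr_gt0 x1.
have fc : {within sphere, continuous f}.
  apply: continuous_in_subspaceT => x; rewrite inE => /sphere0 x0.
  apply: (@continuousM _ _ (qform A) (fun y => (qform B y)^-1) x).
    exact: qform_continuous.
  by apply: continuousV; [rewrite gt_eqF// Bpos|exact: qform_continuous].
have nsphere x : x != 0 -> inv x -> sphere (`|x|^-1 *: x).
  move=> x0 xi; split=> [i|]; first by rewrite !mxE xi.
  by rewrite normrZ normfV normr_id mulVf// normr_eq0.
have sne : sphere !=set0.
  exists (`|const_mx 1 : 'rV[R]_n.+1|^-1 *: const_mx 1); apply: nsphere.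
    by apply/eqP => /matrixP/(_ 0 0)/eqP; rewrite !mxE oner_eq0.
  by move=> i; rewrite !mxE.
have [h] := EVT_max_rV sne sphere_compact fc; rewrite inE => hs fmax.
have h0 := sphere0 h hs; have [hi _] := hs.
pose l := f h; exists l, h.
have le x : inv x -> qform A x <= l * qform B x.
  move=> xi; have [->|x0] := eqVneq x 0.
    by rewrite /qform !mul0mx mxE mulr0.
  have := fmax (`|x|^-1 *: x); rewrite inE => /(_ (nsphere x x0 xi)).
  have n0 : `|x|^-1 ^+ 2 != 0 by rewrite expf_neq0// invr_eq0 normr_eq0.
  by rewrite {1}/f !qformZ -mulf_div divff// mul1r -/l ler_pdivrMr// Bpos.
set M := A - l *: B.
have Ms : M^T = M by rewrite /M linearB linearZ /= As Bs.
have Mneg x : inv x -> qform M x <= 0 by move=> /le; rewrite qformB subr_le0.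
have Mh : qform M h = 0.
  by rewrite qformB /l /f divfK ?subrr// gt_eqF// Bpos.
split=> //; set k := h *m M.
have ki : inv k.
  move=> i; rewrite !mxE (reindex_inj (inv_inj sgK)); apply: eq_bigr => j _.
  by rewrite hi !mxE Asg Bsg.
have t0 (e : R) : 2 * e * (k *m k^T) 0 0 + e ^+ 2 * qform M k <= 0.
  have := Mneg (h + e *: k); rewrite qformD// Mh add0r; apply=> i.
  by rewrite 2!mxE [in RHS]mxE [k]lock !mxE -lock hi ki.
have kk : (k *m k^T) 0 0 = 0.
  set t := (_ *m _) 0 0 in t0 *; have q0 := Mneg k ki; set q := qform M k in t0 q0.
  (* This step makes the quadratic term smaller than the linear one, as q <= 0. *)
  have := t0 (t / (1 - q)); have d0 : 0 < 1 - q by lra.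
  have -> : 2 * (t / (1 - q)) * t + (t / (1 - q)) ^+ 2 * q =
     (t / (1 - q)) ^+ 2 * (2 - q) by field; rewrite gt_eqF.
  rewrite pmulr_lle0; last by lra.
  move=> h1; apply/eqP; have : (t / (1 - q)) ^+ 2 == 0 by rewrite eq_le h1 sqr_ge0.
  by rewrite sqrf_eq0 mulf_eq0 invr_eq0 (gt_eqF d0) orbF.
apply/rowP => i; rewrite [RHS]mxE; apply/eqP; rewrite -sqrf_eq0.
have kE (j : 'I_n.+1) : k^T j 0 = k 0 j by rewrite mxE.
move: kk; rewrite mxE => /eqP; rewrite psumr_eq0 => [/allP/(_ i (mem_index_enum _))|j _].
  by rewrite kE -expr2.
by rewrite kE -expr2 sqr_ge0.
Qed.
End InvariantEigenvector.

(** * Variational bound for the zero nearest to 1 *)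

Lemma qform_sum (R : comPzRingType) (n : nat) (K : 'M[R]_n) (x : 'rV[R]_n) :
  qform K x = \sum_i x 0 i * \sum_j K i j * x 0 j.
Proof.
rewrite /qform mxE.
under eq_bigr do rewrite !mxE mulr_suml.
rewrite exchange_big; apply: eq_bigr => i _; rewrite mulr_sumr.
by apply: eq_bigr => j _; rewrite mulrA.
Qed.

Lemma sum_coefX (R : comNzRingType) (m : nat) (d : nat -> R) (f : {poly R}) :
  \sum_(j < m.+1) d j * ('X * f)`_j = \sum_(j < m) d j.+1 * f`_j.
Proof.
rewrite big_ord_recl coefXM mulr0 add0r; apply: eq_bigr => j _.
by rewrite coefXM /= /bump /= add1n.
Qed.

Lemma sum_coef_quad (R : comNzRingType) (n : nat) (c : int -> R) (a : R)
    (g : {poly R}) (m : nat) : (size g <= n)%N ->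
  \sum_(j < n.+2) c (m.+1%:Z - j%:Z) * (quad a * g)`_j =
  \sum_(j < n) (c (m%:Z - j%:Z + 1) + c (m%:Z - j%:Z - 1) - a * c (m%:Z - j%:Z)) * g`_j.
Proof.
move=> sg; under eq_bigr do rewrite coef_quad mulrDr mulrBr [_ * (a * _)]mulrCA.
rewrite big_split sumrB -mulr_sumr /=.
rewrite !(sum_coefX _ (fun j => c (m.+1%:Z - j%:Z))).
rewrite (sum_coefX _ (fun j => c (m.+1%:Z - j.+1%:Z))).
rewrite [X in _ - _ * X]big_ord_recr [X in _ + X]big_ord_recr /=.
rewrite [X in _ + (X + _)]big_ord_recr /= !(nth_default _ sg).
rewrite [g`_n.+1]nth_default; last exact: leqW.
rewrite !mulr0 !addr0 mulr_sumr -sumrB -big_split /=; apply: eq_bigr => j _.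
have -> : m.+1%:Z - j.+2%:Z = m%:Z - j%:Z - 1 by lia.
have -> : m.+1%:Z - j.+1%:Z = m%:Z - j%:Z by lia.
have -> : m.+1%:Z - j%:Z = m%:Z - j%:Z + 1 by lia.
by ring.
Qed.

Definition reversal (R : nzSemiRingType) (n : nat) (g : {poly R}) : {poly R} :=
  \poly_(i < n) g`_(n.-1 - i).

Lemma coef_quad_reversal (R : comNzRingType) (n : nat) (a : R) (g : {poly R})
    (i : nat) :
  (size g <= n)%N -> (i <= n.+1)%N ->
  (quad a * reversal n g)`_i =
  (quad a * g)`_(n.+1 - i).
Proof.
move=> sg ni; rewrite !coef_quad.
have g0 k : (n <= k)%N -> g`_k = 0 by move=> nk; rewrite nth_default// (leq_trans sg).
have X1 : ('X * reversal n g)`_i = ('X * g)`_(n.+1 - i).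
  case: i ni => [|i] ni; rewrite !coefXM /= ?coef_poly.
    by rewrite g0.
  rewrite subSS subn_eq0; case: ltnP => // ini; congr (g`__); lia.
have X2 : ('X * ('X * reversal n g))`_i = g`_(n.+1 - i).
  case: i ni {X1} => [|[|i]] ni; rewrite !coefXM /= ?coef_poly.
  - by rewrite g0.
  - by rewrite g0 // subn1.
  - by rewrite ifT; [congr (g`__)|]; lia.
have X0 : (reversal n g)`_i = ('X * ('X * g))`_(n.+1 - i).
  rewrite coef_poly !coefXM; case: ltnP => ini; last by do 2!case: eqP => //; lia.
  by rewrite !ifF; [congr (g`__)| |]; lia.
by rewrite X0 X1 X2; ring.
Qed.

Section Rayleigh.
Variables (R : realType) (n : nat) (c : int -> R) (p : {poly R}) (x : R).
Hypothesis cs : forall j : int, (`|j| <= n.+1)%N -> c (- j) = c j.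
Hypotheses (pd : posform n.+2 c) (po : para_orth n.+1 c p) (sp : (size p <= n.+3)%N).
Hypothesis palin : forall i, (i <= n.+2)%N -> p`_(n.+2 - i) = p`_i.
Hypothesis p0 : p`_0 = 1.
Hypothesis left_of :
  forall w : R[i], root (map_poly (real_complex R) p) w -> complex.Re w <= x.

Let A : 'M[R]_n.+1 := \matrix_(i, j) (c (i%:Z - j%:Z + 1) + c (i%:Z - j%:Z - 1)).
Let B : 'M[R]_n.+1 := toeplitz n.+1 c.

Let ceq i j : i = j \/ i = - j -> (`|i| <= n.+1)%N -> c i = c j.
Proof. by case=> [->//|ij] hi; rewrite -cs// ij opprK. Qed.

Let qB y : qform B y = toep_form n.+1 c (fun i => y 0 (inord i)).
Proof.
rewrite qform_sum; apply: eq_bigr => i _; rewrite inord_val; congr (_ * _).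
by apply: eq_bigr => j _; rewrite inord_val mxE.
Qed.

(** The eigenvalue l of the maximizer H is twice the real part of a zero of p:
    (z^2 - l z + 1) H satisfies the orthogonality relations and the symmetry that
    determine p up to a factor, and its zeros lie on the unit circle. *)
Lemma rayleigh_max (g : {poly R}) : (size g <= n.+1)%N -> reversal n.+1 g = g ->
  \sum_(i < n.+1) g`_i * \sum_(j < n.+1) (c (i%:Z - j%:Z + 1) + c (i%:Z - j%:Z - 1)) * g`_j
  <= 2 * x * toep_form n.+1 c (fun i => g`_i).
Proof.
move=> sg pg.
have Bpos y : y != 0 -> 0 < qform B y.
  move=> /rV0Pn[i yi]; rewrite qB; apply: posformW pd _ _.
  by exists i => //; rewrite inord_val.
have [|||||l [h [h0 hi hM hmax]]] :=
  @invariant_eigenvector R n A B (@rev_ord n.+1) _ _ _ _ _ Bpos.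
- by apply/matrixP => i j; rewrite !mxE addrC; have := ltn_ord i; have := ltn_ord j;
    move=> ? ?; congr (_ + _); apply: ceq; lia.
- by apply/matrixP => i j; rewrite !mxE; have := ltn_ord i; have := ltn_ord j;
    move=> ? ?; apply: ceq; lia.
- exact: rev_ordK.
- by move=> i j; rewrite !mxE /=; have := ltn_ord i; have := ltn_ord j;
    move=> ? ?; rewrite addrC; congr (_ + _); apply: ceq; lia.
- by move=> i j; rewrite !mxE /=; have := ltn_ord i; have := ltn_ord j;
    move=> ? ?; apply: ceq; lia.
pose H := rVpoly h; pose F := quad l * H.
have sH : (size H <= n.+1)%N by exact: size_poly.
have HE (j : 'I_n.+1) : H`_j = h 0 j by rewrite coef_rVpoly_ord.
have H0 : H != 0.
  apply: contra h0 => /eqP HH; apply/eqP/rowP => j; rewrite mxE -HE HH coef0 //.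
have palH : reversal n.+1 H = H.
  apply/polyP => i; rewrite coef_poly.
  case: ltnP => [ini|ni]; last by rewrite nth_default// (leq_trans sH).
  by have := hi (Ordinal ini); rewrite -!HE /= subSS.
have Fo : para_orth n.+1 c F.
  move=> m mn; rewrite sum_coef_quad//.
  have /rowP/(_ (Ordinal mn)) := hM; rewrite !mxE => hm; rewrite -[RHS]hm.
  apply: eq_bigr => j _; rewrite !mxE HE mulrC /=; have := ltn_ord j => jn.
  congr (_ * _); rewrite [X in X - _ = _]addrC; congr (_ + _ - _ * _); apply: ceq; lia.
have sF : (size F <= n.+3)%N.
  by apply: leq_trans (size_polyMleq _ _) _; rewrite size_quad !addSn add0n /= !ltnS.
have FE : F = F`_0 *: p.
  apply: (self_reciprocal_unique pd po sp palin p0) => // i ni.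
  by rewrite -coef_quad_reversal// palH.
have F0 : F != 0.
  rewrite mulf_neq0//; apply/eqP => h1; have := size_quad l; by rewrite h1 size_poly0.
have Fz : F`_0 != 0 by apply: contraNneq F0 => f0; rewrite FE f0 scale0r.
have [a qa] : exists a : R[i], root (map_poly (real_complex R) (quad l)) a.
  by apply/closed_rootP; rewrite size_map_poly size_quad.
have pa : root (map_poly (real_complex R) p) a.
  have : root (map_poly (real_complex R) F) a by rewrite rmorphM rootM qa.
  rewrite FE linearZ /= rootZ// ; apply: contra Fz => /eqP; move/complexI => ->//.
have a1 := root_circle pd po sp palin p0 pa.
have lE : l = 2 * complex.Re a.
  move: qa; rewrite /root horner_map_quad expr2; case: a a1 {pa} => u v /= uv.
  rewrite eq_complex /= => /andP[/eqP h1 /eqP h2].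
  have : v * (2 * u - l) = 0 by lra.
  move=> /eqP; rewrite mulf_eq0 subr_eq0 => /orP[/eqP v0|/eqP//].
  have : u * (2 * u - l) = 0 by rewrite v0 in uv h1; nra.
  move=> /eqP; rewrite mulf_eq0 subr_eq0 => /orP[/eqP u0|/eqP//].
  by move: uv; rewrite u0 v0 expr0n addr0 => /eqP; rewrite eq_sym oner_eq0.
pose y : 'rV[R]_n.+1 := poly_rV g.
have yE (i : 'I_n.+1) : y 0 i = g`_i by rewrite mxE.
have := hmax y; rewrite qB.
have -> : toep_form n.+1 c (fun i => y 0 (inord i)) = toep_form n.+1 c (fun i => g`_i).
  apply: eq_bigr => i _; rewrite yE inord_val; congr (_ * _); apply: eq_bigr => j _.
  by rewrite yE inord_val.
rewrite qform_sum.
have -> : \sum_i y 0 i * (\sum_j A i j * y 0 j) =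
  \sum_(i < n.+1) g`_i * \sum_(j < n.+1) (c (i%:Z - j%:Z + 1) + c (i%:Z - j%:Z - 1)) * g`_j.
  by apply: eq_bigr => i _; rewrite yE; congr (_ * _); apply: eq_bigr => j _; rewrite yE mxE.
move=> hm; apply: le_trans (hm _) _.
  move=> i; rewrite !yE -[in RHS]pg coef_poly ltn_ord; congr (g`__) => /=; lia.
apply: ler_wpM2r; last by rewrite lE ler_pM2l// left_of.
case: (pselect (exists2 i, (i < n.+1)%N & g`_i != 0)) => [/(posformW pd)/ltW//|ng].
rewrite /toep_form big1// => i _; suff -> : g`_i = 0 by rewrite mul0r.
by apply/eqP/negPn/negP => gi; apply: ng; exists i.
Qed.
End Rayleigh.

(** * The zero nearest to -1 *)

Section NearestZero.
Variables (R : realType) (n : nat) (c : int -> R) (phi : R).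
Hypothesis cs : forall j : int, (`|j| <= n)%N -> c (- j) = c j.
Hypothesis pd : posform n.+1 c.
Let p := parapoly n c.
Let pC := map_poly (real_complex R) p.
Let P := paraorthopoly n (fun j => (c j)%:C) ((-1) ^+ n).
Hypothesis p_ge0 : forall i, 0 <= p`_i.
Hypothesis hphi : upper_root_nearest_m1 P phi.

Let pdt : posform n.+1 (twist c). Proof. exact: posform_twist. Qed.
Let po : para_orth n (twist c) p. Proof. exact: parapoly_orth. Qed.
Let sp : (size p <= n.+2)%N. Proof. exact: size_parapoly. Qed.
Let palin i : (i <= n.+1)%N -> p`_(n.+1 - i) = p`_i. Proof. exact: parapoly_palin. Qed.
Let p0 : p`_0 = 1. Proof. by apply/parapoly_coef0/posform_det/posformW. Qed.

Let rootP w : root P (- w) = root pC w.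
Proof.
have -> : pC = flippoly n P by rewrite flippoly_paraorthopoly.
rewrite /flippoly rootZ ?signr_eq0//.
by rewrite /root horner_comp hornerN hornerX.
Qed.

Let norm_le (a b : R[i]) : `|a| <= `|b| ->
  complex.Re a ^+ 2 + complex.Im a ^+ 2 <= complex.Re b ^+ 2 + complex.Im b ^+ 2.
Proof.
move=> ab; have : `|a| ^+ 2 <= `|b| ^+ 2 by rewrite lerXn2r// ?nnegrE.
by rewrite -!add_Re2_Im2 lecR.
Qed.

(** The angle of the nearest zero of P is measured from -1, hence pi - phi.  The
    quotient g has no zero on the boundary of the sector because the zeros of p
    are simple. *)
Lemma nearest_zero_factor :
  (forall w, root pC w -> complex.Re w <= cos (pi - phi)) /\
  exists g : {poly R}, [/\ p = quad (2 * cos (pi - phi)) * g,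
    (size g <= n)%N, reversal n g = g & forall j, (j < n)%N -> 0 < g`_j].
Proof.
have [/andP[phi0 phipi] proot pmin] := hphi.
have cosE : cos (pi - phi) = - cos phi by rewrite addrC cosDpi cosN.
have left_of w : root pC w -> complex.Re w <= cos (pi - phi).
  move=> pw; have w1 := root_circle pdt po sp palin p0 pw.
  have [wI|wI] := eqVneq (complex.Im w) 0.
    have : (complex.Re w - 1) * (complex.Re w + 1) = 0.
      move: w1; rewrite wI expr0n addr0 -subr_sqr_1 => ->.
      by rewrite subrr.
    move/eqP; rewrite mulf_eq0 subr_eq0 addr_eq0 => /orP[/eqP wR|/eqP ->];
      last exact: cos_geN1.
    have wE : w = 1%:C by case: w wI wR {pw w1} => u v /= -> ->.
    move: pw; rewrite wE fmorph_root /root horner_coef => /eqP h.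
    have : 0 < \sum_(i < size p) p`_i * 1 ^+ i.
      have sp0 : (0 < size p)%N.
        rewrite size_poly_gt0; apply/eqP => pz; have := p0.
        by rewrite pz coef0 => /eqP; rewrite eq_sym oner_eq0.
      rewrite (bigD1 (Ordinal sp0))//= p0 mul1r expr0 ltr_pwDl//.
      by apply: sumr_ge0 => i _; rewrite expr1n mulr1.
    by rewrite h ltxx.
  (* The zero of P in the upper half-plane that comes from w or conj(w). *)
  have [u [uI uR ur]] : exists u : R[i],
      [/\ 0 < complex.Im u, complex.Re u = - complex.Re w & root P u].
    case: (ltrP 0 (complex.Im w)) => h.
      exists (- w^*%C); split; last by rewrite rootP; exact: root_conj.
        by case: w h {pw w1 wI} => a b /=; rewrite opprK.
      by case: w {pw w1 wI h} => a b.
    exists (- w); split; last by rewrite rootP.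
      by case: w h wI {pw w1} => a b /= h h0; rewrite oppr_gt0 lt_neqAle h0.
    by case: w {pw w1 wI h} => a b.
  have uI2 : complex.Im u ^+ 2 = complex.Im w ^+ 2.
    have := root_circle pdt po sp palin p0 (a := - u).
    rewrite -rootP opprK => /(_ ur); case: u uR {uI ur} => a b /= -> ; lra.
  have := norm_le (pmin u ur uI).
  case: u uR uI2 {uI ur} => a b /= aE bE.
  rewrite oppr0 !subr0 !opprK aE cosE => le2.
  by have := cos2Dsin2 phi; move: bE w1 le2; nra.
split=> //.
have sth : 0 < sin (pi - phi) by rewrite sin_gt0_pi// subr_gt0 phipi ltrBlDr ltrDl.
set th := pi - phi in cosE left_of sth *.
have pth : root pC (expi th).
  have e : expi th = (- expi phi)^*%C.
    by rewrite /th /expi addrC cosDpi sinDpi cosN sinN; simpc; rewrite /= opprK.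
  by rewrite e; apply: root_conj; rewrite -rootP opprK.
have cs1 := cos2Dsin2 th.
have /dvdpP[g] := dvdp_real_quadratic pth (lt0r_neq0 sth).
rewrite /= cs1 mulrC => pE; exists g.
have pn1 : p`_n.+1 = 1 by rewrite -[n.+1]subn0 palin.
have szp : size p = n.+2 := size_self_reciprocal sp palin p0.
have quadm : quad (2 * cos th) \is monic.
  rewrite monicE lead_coefE size_quad !(coefD, coefN, coefZ, coefX, coefXn, coefC).
  by rewrite /= mulr0 oppr0 !addr0.
have gn0 : g != 0.
  by apply/eqP => g0; have := szp; rewrite pE g0 mulr0 size_poly0.
have szg : size g = n.
  by have := szp; rewrite pE size_monicM// size_quad !addSn /= => -[].
have gm : g \is monic.
  have : p \is monic by rewrite monicE lead_coefE szp pn1.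
  by rewrite pE monicMl.
have palg : reversal n g = g.
  apply: (mulfI (x := quad (2 * cos th))).
    exact: monic_neq0.
  apply/polyP => i; have [ni|ni] := leqP i n.+1.
    by rewrite coef_quad_reversal ?szg// -pE palin.
  rewrite -pE [p`_i]nth_default ?szp// nth_default//.
  apply: leq_trans (size_polyMleq _ _) _; rewrite size_quad !addSn add0n /=.
  by apply: leq_trans ni; rewrite !ltnS; exact: size_poly.
split=> //; first by rewrite szg.
move=> j jn; apply: (@nearest_zeros_quotient_gt0 _ th) => //; rewrite ?szg//.
- by rewrite /th subr_gt0 phipi ltrBlDr ltrDl.
- by rewrite -(coef_quad0 (2 * cos th)) -pE p0.
- move=> w gw.
  have pw : root pC w by rewrite /pC pE rmorphM rootM gw orbT.
  have w1 := root_circle pdt po sp palin p0 pw.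
  split=> //; rewrite lt_neqAle left_of// andbT; apply/eqP => wR.
  have qw : root (map_poly (real_complex R) (quad (2 * cos th))) w.
    rewrite /root horner_map_quad expr2 -wR; case: w w1 {gw pw wR} => u v /= uv.
    by rewrite eq_complex /=; apply/andP; split; apply/eqP; [nra|ring].
  have [v vE] := factor_theorem _ _ gw; have [u uE] := factor_theorem _ _ qw.
  apply: (root_simple pdt po sp palin p0 pw (h := u * v)).
  by rewrite -/pC /pC pE rmorphM /= [map_poly _ g]vE; rewrite [map_poly _ (_ + _)]uE; ring.
- by move=> i; rewrite -pE.
Qed.
End NearestZero.

Lemma toeplitz_sym_even (K : Type) (n : nat) (c : int -> K) :
  (toeplitz n.+1 c)^T = toeplitz n.+1 c ->
  forall j : int, (`|j| <= n)%N -> c (- j) = c j.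
Proof.
move=> cT j jn; have jn' : (`|j| < n.+1)%N by [].
have /matrixP/(_ (Ordinal jn') ord0) := cT; rewrite !mxE /= => h.
have [j0|j0] := leP 0 j.
  by transitivity (c (0%:Z - `|j|%:Z)); [congr c; lia|rewrite h; congr c; lia].
by transitivity (c (`|j|%:Z - 0%:Z)); [congr c; lia|rewrite -h; congr c; lia].
Qed.

Lemma twist_even (R : pzRingType) (n : nat) (c : int -> R) :
  (forall j : int, (`|j| <= n)%N -> c (- j) = c j) ->
  forall j : int, (`|j| <= n)%N -> twist c (- j) = twist c j.
Proof. by move=> cs j jn; rewrite /twist abszN cs. Qed.

(** * Comparison of two sequences of moments *)

Section Comparison.
Variables (R : realType) (n k : nat) (c d : int -> R) (phi psi : R).
Hypotheses (n0 : (0 < n)%N) (kn : (k <= n)%N).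
Hypothesis cs : forall j : int, (`|j| <= n)%N -> c (- j) = c j.
Hypothesis ds : forall j : int, (`|j| <= n)%N -> d (- j) = d j.
Hypotheses (cpd : posform n.+1 c) (dpd : posform n.+1 d).
Hypothesis cd : forall j : int, (`|j| <= n)%N -> `|j|%N != k -> c j = d j.
Hypothesis cp : forall i, 0 <= (parapoly n c)`_i.
Hypothesis dp : forall i, 0 <= (parapoly n d)`_i.
Hypothesis hphi :
  upper_root_nearest_m1 (paraorthopoly n (fun j => (c j)%:C) ((-1) ^+ n)) phi.
Hypothesis hpsi :
  upper_root_nearest_m1 (paraorthopoly n (fun j => (d j)%:C) ((-1) ^+ n)) psi.
Let delta := (-1) ^+ k * c k%:Z - (-1) ^+ k * d k%:Z.
Let p := parapoly n d.

Let twist_delta (j : int) : (`|j| <= n)%N ->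
  twist c j - twist d j = if `|j|%N == k then delta else 0.
Proof.
move=> jn; case: eqP => jk; last by rewrite /twist cd ?subrr//; exact/eqP.
have ck (e : int -> R) : (forall j : int, (`|j| <= n)%N -> e (- j) = e j) -> e j = e k%:Z.
  move=> es; have [j0|j0] := leP 0 j; first by congr e; lia.
  by rewrite -es//; congr e; lia.
by rewrite /twist jk (ck _ cs) (ck _ ds).
Qed.

(** The factor g belonging to d is a test vector for the variational bound for
    c.  For the moments of d the form A - 2 cos(pi - psi) B vanishes at g, so only
    the change of the k-th moment remains. *)
Lemma rayleigh_gap : exists2 g : {poly R}, (forall i, (i < n)%N -> 0 < g`_i) &
  exists2 b, 0 < b &
    delta * (\sum_(i < n) g`_i * \sum_(j < n.+2) (`|i.+1%:Z - j%:Z|%N == k)%:R * p`_j) <=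
      2 * (cos psi - cos phi) * b.
Proof.
have [cleft _] := nearest_zero_factor cs cpd cp hphi.
have [_ [g [pE sg pg g0]]] := nearest_zero_factor ds dpd dp hpsi.
exists g => //; exists (toep_form n (twist c) (fun i => g`_i)).
  apply: posformW; first exact: posform_twist.
  by exists 0%N => //; rewrite gt_eqF// g0.
have cosE (x : R) : cos (pi - x) = - cos x by rewrite addrC cosDpi cosN.
have := @rayleigh_max R n.-1 (twist c) (parapoly n c) (cos (pi - phi)).
rewrite prednK// => /(_ (twist_even cs) (posform_twist cpd) (parapoly_orth cs)).
move=> /(_ (size_parapoly _ _) (fun i => @parapoly_palin _ n c i)).
move=> /(_ (parapoly_coef0 (posform_det (posformW cpd))) cleft g sg pg).
set S1 := \sum_(i < n) _ => ray; set B := toep_form _ _ _ in ray *.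
have E : delta * (\sum_(i < n) g`_i * \sum_(j < n.+2) (`|i.+1%:Z - j%:Z|%N == k)%:R * p`_j) =
    S1 - 2 * cos (pi - psi) * B.
  transitivity (\sum_(i < n) g`_i * \sum_(j < n.+2) twist c (i.+1%:Z - j%:Z) * p`_j).
    rewrite mulr_sumr; apply: eq_bigr => i _; rewrite mulrCA; congr (_ * _).
    have := parapoly_orth ds (ltn_ord i); rewrite -/p => od.
    rewrite -[RHS]subr0 -[X in _ - X]od -sumrB mulr_sumr; apply: eq_bigr => j _.
    rewrite -mulrBl twist_delta; last by have := ltn_ord i; have := ltn_ord j; lia.
    by case: eqP => _ /=; [rewrite mul1r|rewrite !mul0r mulr0].
  rewrite /S1 /B /toep_form mulr_sumr -sumrB; apply: eq_bigr => i _.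
  rewrite /p pE sum_coef_quad// mulrCA -mulrBr; congr (_ * _).
  by rewrite mulr_sumr -sumrB; apply: eq_bigr => j _; ring.
rewrite E; move: ray; rewrite !cosE; lra.
Qed.

Let phiI : phi \in `[0, pi].
Proof. by have [/andP[/ltW h /ltW h'] _ _] := hphi; rewrite in_itv/= h. Qed.

Let psiI : psi \in `[0, pi].
Proof. by have [/andP[/ltW h /ltW h'] _ _] := hpsi; rewrite in_itv/= h. Qed.

Lemma nearest_zero_le : 0 <= delta -> psi <= phi.
Proof.
move=> d0; have [g g0 [b b0 h]] := rayleigh_gap.
rewrite leNgt -ltr_cos// -leNgt -subr_ge0 -(pmulr_lge0 _ b0).
suff : 0 <= 2 * (cos psi - cos phi) * b by lra.
apply: le_trans h; apply: mulr_ge0 => //; apply: sumr_ge0 => i _.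
apply: mulr_ge0; first exact/ltW/g0.
by apply: sumr_ge0 => j _; rewrite mulr_ge0 ?ler0n ?dp.
Qed.

Lemma nearest_zero_lt : 0 < delta -> (k = 0%N -> p <> 1 + 'X^(n.+1)) -> psi < phi.
Proof.
move=> d0 pX; have [g g0 [b b0 h]] := rayleigh_gap.
rewrite -ltr_cos// -subr_gt0 -(pmulr_lgt0 _ b0).
suff : 0 < 2 * (cos psi - cos phi) * b by lra.
apply: lt_le_trans h; apply: mulr_gt0 => //.
have pos (i : 'I_n) (j : 'I_n.+2) : `|i.+1%:Z - j%:Z|%N = k -> 0 < p`_j ->
    0 < \sum_(i < n) g`_i * \sum_(j < n.+2) (`|i.+1%:Z - j%:Z|%N == k)%:R * p`_j.
  move=> ij pj; rewrite (bigD1 i)//=; apply: ltr_pwDl.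
    apply: mulr_gt0; first exact: g0.
    rewrite (bigD1 j)//= ij eqxx mul1r; apply: ltr_pwDl => //.
    by apply: sumr_ge0 => l _; rewrite mulr_ge0 ?ler0n ?dp.
  apply: sumr_ge0 => l _; apply: mulr_ge0; first exact/ltW/g0.
  by apply: sumr_ge0 => l' _; rewrite mulr_ge0 ?ler0n ?dp.
have p0 : p`_0 = 1 by apply/parapoly_coef0/posform_det/posformW.
have [k0|k0] := posnP k; last first.
  have kn' : (k.-1 < n)%N by rewrite prednK.
  by apply: (pos (Ordinal kn') ord0) => /=; [lia|rewrite p0].
have [i pi0] : exists i : 'I_n, p`_i.+1 != 0.
  apply: contrapT => np; apply: (pX k0); apply/polyP => i.
  have pn1 : p`_n.+1 = 1 by rewrite -[n.+1]subn0 parapoly_palin.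
  rewrite [RHS]coefD coef1 coefXn; case: i => [|i] /=; first by rewrite p0 addr0.
  rewrite add0r eqSS; case: (ltngtP i n) => [ni|ni|->//].
    by apply/eqP/negPn/negP => pi; apply: np; exists (Ordinal ni).
  by rewrite nth_default// (leq_trans (size_parapoly _ _)).
have ji : (i.+1 < n.+2)%N by rewrite ltnS ltnW// ltnS.
by apply: (pos i (Ordinal ji)); rewrite /= ?k0 ?subrr// lt_neqAle eq_sym pi0 dp.
Qed.
End Comparison.

(** * Motion of the nearest zero *)

Lemma nonneg_coefs_real (R : realType) (p : {poly R}) :
  nonneg_coefs (map_poly (real_complex R) p) <-> forall i, 0 <= p`_i.
Proof. by split=> h i; have := h i; rewrite coef_map ler0c. Qed.

Unset Implicit Arguments.

Theorem corollary2p7 (R : realType) (n k : nat) (J : set R) (c : int -> R -> R)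
  (hn : (1 <= n)%N) (hk : (k <= n)%N)
  (hJopen : open J) (hJitv : is_interval J)
  (hsym : forall t, J t ->
     (toeplitz n.+1 (c ^~ t))^T = toeplitz n.+1 (c ^~ t))
  (hpos : forall t, J t -> posdef (toeplitz n.+1 (c ^~ t)))
  (hC1 : forall j : int, (absz j <= n)%N -> C1_on J (c j))
  (hconst : forall j : int, (absz j <= n)%N -> absz j != k ->
     forall s t, J s -> J t -> c j s = c j t) :
  let b : R[i] := (-1) ^+ n in
  let P (t : R) : {poly R[i]} :=
    paraorthopoly n (fun j : int => (c j t)%:C) b in
  let p (t : R) : {poly R[i]} := flippoly n (P t) in
  ((forall t, J t -> totally_nonneg (toeplitz n.+1 (c ^~ t))) ->
     forall t, J t -> nonneg_coefs (p t)) /\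
  ((forall t, J t -> nonneg_coefs (p t)) ->
   forall phi : R -> R,
     (forall t, J t -> upper_root_nearest_m1 (P t) (phi t)) ->
     ((1 <= k)%N ->
        (noninc_on J (fun t => (-1) ^+ k * c k%:Z t) -> noninc_on J phi) /\
        (strict_dec_on J (fun t => (-1) ^+ k * c k%:Z t) ->
           strict_dec_on J phi)) /\
     (k = 0%N ->
        (noninc_on J (c 0) -> noninc_on J phi) /\
        (strict_dec_on J (c 0) ->
           (forall t, J t -> p t <> 1 + 'X^(n.+1)) -> strict_dec_on J phi))).
Proof.
move=> b P p.
have pE t : p t = map_poly (real_complex R) (parapoly n (c ^~ t)).
  exact: flippoly_paraorthopoly.
split=> [tn t Jt|hp phi hphi].
  by rewrite pE; apply/nonneg_coefs_real => i; apply: parapoly_ge0; exact: tn.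
have even t : J t -> forall j : int, (`|j| <= n)%N -> c (- j) t = c j t.
  by move=> /hsym; exact: toeplitz_sym_even.
have pd t : J t -> posform n.+1 (c ^~ t) by move=> /hpos; exact: posdef_posform.
have p0 t : J t -> forall i, 0 <= (parapoly n (c ^~ t))`_i.
  by move=> /hp; rewrite pE => /nonneg_coefs_real.
have le s t : J s -> J t ->
    0 <= (-1) ^+ k * c k%:Z s - (-1) ^+ k * c k%:Z t -> phi t <= phi s.
  move=> Js Jt; apply: (@nearest_zero_le R n k (c ^~ s) (c ^~ t)) => //;
    by [exact: even|exact: pd|exact: p0|exact: hphi|move=> j jn jk; exact: hconst].
have lt s t : J s -> J t -> (k = 0%N -> p t <> 1 + 'X^(n.+1)) ->
    0 < (-1) ^+ k * c k%:Z s - (-1) ^+ k * c k%:Z t -> phi t < phi s.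
  move=> Js Jt pX d0; apply: (@nearest_zero_lt R n k (c ^~ s) (c ^~ t)) => //;
    try by [exact: even|exact: pd|exact: p0|exact: hphi|move=> j jn jk; exact: hconst].
  move=> k0 pt; apply: (pX k0).
  by rewrite pE pt rmorphD rmorph1 /= map_polyXn.
split=> [k0|k0]; split.
- move=> h s t Js Jt st; move: (Js) (Jt); rewrite !inE => Js' Jt'.
  by apply: le => //; rewrite subr_ge0; exact: h.
- move=> h s t Js Jt st; move: (Js) (Jt); rewrite !inE => Js' Jt'.
  by apply: lt => // [k1|]; [rewrite k1 in k0|rewrite subr_gt0; exact: h].
- move=> h s t Js Jt st; move: (Js) (Jt); rewrite !inE => Js' Jt'.
  by apply: le => //; rewrite k0 !mul1r subr_ge0; exact: h.
- move=> h pX s t Js Jt st; move: (Js) (Jt); rewrite !inE => Js' Jt'.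
  by apply: lt => // [_|]; [exact: pX|rewrite k0 !mul1r subr_gt0; exact: h].
Qed.
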